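(* Let $\mathcal{S} = \{(p',q') \in [0,1]^{2} : 0 < p'+q' \leqslant 1\}$. For all $(p,q) \in \mathcal{S}$, the probabilistic cellular automaton $F_{p,q}$ is ergodic.
   Context: A (one-dimensional) probabilistic cellular automaton (PCA) $F$ with finite alphabet $\mathcal{A}$, neighbourhood $\mathcal{N}=\{y_1,\dots,y_m\}\subset\mathbb{Z}$ and stochastic matrix $\varphi:\mathcal{A}^{m}\times\mathcal{A}\to[0,1]$ acts on configurations $\eta\in\mathcal{A}^{\mathbb{Z}}$ as follows: given $\eta$, the random configuration $F\eta\in\mathcal{A}^{\mathbb{Z}}$ has independent coordinates, with $\mathbf{P}[F\eta(x)=b]=\varphi(\eta(x+y_1),\dots,\eta(x+y_m),b)$ for $x\in\mathbb{Z}$, $b\in\mathcal{A}$. If $\eta$ is random with law $\mu$ (a probability measure on $\mathcal{A}^{\mathbb{Z}}$ with the $\sigma$-field generated by cylinder sets), $F\mu$ denotes the law of $F\eta$, and $F^{t}\mu=F(F^{t-1}\mu)$. A measure $\mu$ is stationary for $F$ if $F\mu=\mu$. The PCA $F$ is ergodic if it has a unique stationary measure $\mu$ and, for every probability measure $\nu$ on $\mathcal{A}^{\mathbb{Z}}$, $F^{t}\nu$ converges weakly to $\mu$ as $t\to\infty$. The PCA $F_{p,q}$ has alphabet $\mathcal{A}=\{0,1\}$, neighbourhood $\mathcal{N}=\{0,1,2\}$ and stochastic matrix $\varphi_{p,q}$ given by $\varphi_{p,q}(0,0,0,0)=p$, $\varphi_{p,q}(0,0,0,1)=1-p$, and $\varphi_{p,q}(a_0,a_1,a_2,0)=1-q$,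 $\varphi_{p,q}(a_0,a_1,a_2,1)=q$ for all $(a_0,a_1,a_2)\in\{0,1\}^3\setminus\{(0,0,0)\}$. *)

(* Defs.v *)
From HB Require Import structures.
From mathcomp Require Import all_boot all_order all_algebra.
From mathcomp Require Import all_classical all_reals all_analysis.
From mathcomp Require Import measurable_realfun giry.
Set Implicit Arguments.
Unset Strict Implicit.
Unset Printing Implicit Defensive.
Import Order.TTheory GRing.Theory Num.Theory.
Import numFieldNormedType.Exports.
Local Open Scope classical_set_scope.
Local Open Scope ring_scope.

(* A point is required because a [measurableType] is pointed. *)
#[short(type="alphabetType")]
HB.structure Definition Alphabet := {T of Finite T & Pointed T}.
HB.saturate bool.

Definition config (A : alphabetType) : Type :=
  prod_topology (fun _ : int => discrete_topology A).

HB.instance Definition _ (A : alphabetType) := Pointed.on (config A).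
HB.instance Definition _ (A : alphabetType) := Topological.on (config A).

Definition depends_on (A : alphabetType) (U : Type) (J : seq int)
    (g : config A -> U) :=
  forall eta xi : config A, (forall x, x \in J -> eta x = xi x) -> g eta = g xi.

Definition cylinder (A : alphabetType) : set (set (config A)) :=
  [set S | exists J, depends_on J S].

HB.instance Definition _ (A : alphabetType) :=
  Measurable.copy (config A) (g_sigma_algebraType (@cylinder A)).

Definition elem_cylinder (A : alphabetType) (J : seq int) (b : config A) :
    set (config A) :=
  [set eta | forall x, x \in J -> eta x = b x].

Section depends_on_theory.
Variable A : alphabetType.
Implicit Types (J K : seq int) (S : set (config A)).

Lemma depends_on_sub U J K (g : config A -> U) :
  {subset J <= K} -> depends_on J g -> depends_on K g.
Proof. by move=> JK gJ eta xi e; apply: gJ => x /JK; exact: e. Qed.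

Lemma depends_on_catl U J K (g : config A -> U) :
  depends_on J g -> depends_on (J ++ K) g.
Proof. by apply: depends_on_sub => x; rewrite mem_cat => ->. Qed.

Lemma depends_on_catr U J K (g : config A -> U) :
  depends_on K g -> depends_on (J ++ K) g.
Proof. by apply: depends_on_sub => x; rewrite mem_cat orbC => ->. Qed.

Lemma depends_onP J S : depends_on J S <->
  forall eta xi, (forall x, x \in J -> eta x = xi x) -> S eta -> S xi.
Proof.
split=> [SJ eta xi e|SJ eta xi e]; first by rewrite (SJ _ _ e).
by apply/propext; split; apply: SJ => // x xJ; rewrite e.
Qed.

Lemma cylinder0 : cylinder (set0 : set (config A)).
Proof. by exists [::]. Qed.

Lemma cylinderU : setU_closed (@cylinder A).
Proof.
move=> S T [J SJ] [K TK]; exists (J ++ K) => eta xi e.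
by rewrite /setU/= (depends_on_catl SJ e) (depends_on_catr TK e).
Qed.

Lemma cylinderC : setC_closed (@cylinder A).
Proof. by move=> S [J SJ]; exists J => eta xi e; rewrite /setC/= (SJ _ _ e). Qed.

Lemma cylinderI : setI_closed (@cylinder A).
Proof.
by move=> S T cS cT; rewrite -[_ `&` _]setCK setCI; apply: cylinderC;
  apply: cylinderU; exact: cylinderC.
Qed.

Lemma elem_cylinder_dep J b : depends_on J (@elem_cylinder A J b).
Proof. by apply/depends_onP => eta xi e Je x xJ; rewrite -e ?Je. Qed.

Lemma measurable_cylinder S : cylinder S -> measurable S.
Proof. by move=> cS; exact: sub_sigma_algebra. Qed.

Lemma open_cylinder S : cylinder S -> open S.
Proof.
move=> [J /depends_onP SJ]; rewrite openE => eta Seta; rewrite /interior.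
have : \forall xi \near eta, forall x, x \in J -> xi x = eta x.
  elim: J {SJ} => [|x J IH]; first by near=> xi => x; rewrite in_nil.
  have h : \forall xi \near eta, xi x = eta x.
    have := @proj_continuous int (fun=> discrete_topology A) x eta.
    by move=> /(_ [set eta x]); apply; exact: discrete_set1.
  near=> xi => y; rewrite inE => /orP[/eqP ->|].
    by near: xi.
  by move: y; near: xi.
by apply: filterS => xi e; apply: SJ Seta => x xJ; rewrite e.
Unshelve. all: by end_near. Qed.

Lemma compact_config : compact [set: config A].
Proof.
have := @tychonoff int (fun=> discrete_topology A) (fun=> setT)
  (fun=> @finite_compact (discrete_topology A) setT (@finite_finset A setT)).
by congr (compact _); rewrite eqEsubset.
Qed.

End depends_on_theory.

(* An alias of [config] that carries only the algebra of cylinder sets;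
   [config] itself carries the sigma-algebra they generate. *)
Definition cylinder_alg (A : alphabetType) : Type := config A.
HB.instance Definition _ (A : alphabetType) := Pointed.on (cylinder_alg A).
Definition cylinder_alg_display : measure_display. Proof. exact. Qed.
HB.instance Definition _ (A : alphabetType) :=
  isAlgebraOfSets.Build cylinder_alg_display (cylinder_alg A)
    (@cylinder0 A) (@cylinderU A) (@cylinderC A).

Section cylinder_extension.
Variables (A : alphabetType) (R : realType).
Let T := cylinder_alg A.
Variable m : set T -> \bar R.
Hypothesis m0 : m set0 = 0%E.
Hypothesis m_ge0 : forall S, (0 <= m S)%E.
Hypothesis m_add : forall S S' : set T, cylinder S -> cylinder S' ->
  S `&` S' = set0 -> m (S `|` S') = (m S + m S')%E.

Let m_semi_additive : measure_function.semi_additive m.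
Proof. exact/additive2P. Qed.

(* By compactness, a disjoint sequence of cylinders whose union is a cylinder
   has only finitely many nonempty terms. *)
Let m_semi_sigma_additive : semi_sigma_additive m.
Proof.
move=> F cF tF cUF.
have [N FN] : exists N, forall n, (N <= n)%N -> F n = set0.
  have cptU : compact (\bigcup_n F n : set (config A)).
    apply: (@subclosed_compact _ _ [set: config A]) => //; last first.
      exact: compact_config.
    by rewrite -[X in closed X]setCK; apply: open_closedC; apply: open_cylinder;
      exact: cylinderC.
  move: cptU; rewrite compact_cover => /(_ nat setT F).
  case=> [i _|//|D _ Dcov]; first exact: open_cylinder (cF i).
  exists (\max_(i <- finmap.enum_fset D) i).+1 => n Dn.
  apply/seteqP; split => // x Fx.
  have [i /= iD Fix] := Dcov x (ex_intro2 _ _ n I Fx).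
  have := tF i n I I (ex_intro _ x (conj Fix Fx)) => ein.
  by move: Dn; rewrite -ein ltnNge leq_bigmax_seq.
have -> : \bigcup_n F n = \big[setU/set0]_(i < N) F i.
  rewrite -bigcup_mkord; apply/seteqP; split=> x [n _ Fx]; last by exists n.
  exists n => //=; rewrite ltnNge; apply/negP => /FN F0.
  by move: Fx; rewrite F0.
rewrite m_semi_additive//; last first.
  by apply: bigsetU_measurable => i _; exact: cF.
rewrite (_ : \sum_(i < N) _ = \sum_(0 <= i < N) m (F i))%E; last first.
  by rewrite big_mkord.
apply: cvg_near_cst; near=> n.
rewrite (big_cat_nat (n := N)) //=; last by near: n; exact: nbhs_infty_ge.
rewrite [X in (_ + X)%E]big_nat_cond [X in (_ + X)%E]big1 ?adde0//.
by move=> i /andP[/andP[Ni _] _]; rewrite FN// m0.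
Unshelve. all: by end_near. Qed.

Lemma cylinder_extension : m setT = 1%E ->
  exists P : probability (config A) R, forall S, cylinder S -> P S = m S.
Proof.
move=> m1.
pose mM := isMeasure.Build _ T R m m0 m_ge0
  m_semi_sigma_additive.
pose mT : {measure set T -> \bar R} :=
  HB.pack_for (measure T R) m mM.
pose T' := g_sigma_algebraType (@measurable _ T).
pose Q : {measure set T' -> \bar R} := measure_extension mT.
have QE S : cylinder S -> Q S = m S.
  by move=> cS; rewrite [LHS]measurable_mu_extE.
have Q1 : Q setT = 1%E by rewrite QE//; exists [::].
pose P : probability T' R :=
  HB.pack_for (probability T' R) (Measure.sort Q)
    (Measure_isProbability.Build _ _ _ Q Q1).
by exists P.
Qed.

End cylinder_extension.
Section product_law.
Variables (A : alphabetType) (R : realType) (p : int -> A -> R).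
Hypothesis p_ge0 : forall x a, 0 <= p x a.
Hypothesis p_sum1 : forall x, \sum_a p x a = 1.
Implicit Types (J K : seq int) (g : config A -> R) (eta b : config A).

Let upd eta (x : int) (a : A) : config A := fun y => if y == x then a else eta y.

(* [mean1 x g] averages out the coordinate [x] of [g] under [p x]; a cylinder
   set depending on the coordinates in [J] gets weight [mean J] of its
   indicator, which is a constant function. *)
Let mean1 x g : config A -> R := fun eta => \sum_a p x a * g (upd eta x a).

Let mean J g := foldr mean1 g J.

Let mean1_dep x J g : depends_on (x :: J) g -> depends_on J (mean1 x g).
Proof.
move=> gJ eta xi e; apply: eq_bigr => a _; congr (_ * _); apply: gJ => y.
by rewrite /upd inE; case: eqP => //= _; exact: e.
Qed.

Let mean_dep J K g : depends_on (J ++ K) g -> depends_on K (mean J g).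
Proof.
elim: J K => [|x J IH] K //= gJ; apply: mean1_dep; apply: IH.
by apply: depends_on_sub gJ => y; rewrite !(inE, mem_cat) orbCA.
Qed.

Let mean1_id x J g : x \notin J -> depends_on J g -> mean1 x g = g.
Proof.
move=> xJ gJ; apply/funext => eta; rewrite /mean1.
rewrite (eq_bigr (fun a => p x a * g eta)) -?mulr_suml ?p_sum1 ?mul1r// => a _.
congr (_ * _); apply: gJ => y yJ; rewrite /upd; case: eqP => // yx.
by rewrite -yx yJ in xJ.
Qed.

Let mean_id J g : depends_on [::] g -> mean J g = g.
Proof. by move=> g0; elim: J => //= x J ->; exact: mean1_id g0. Qed.

Let mean1C x y g : mean1 x (mean1 y g) = mean1 y (mean1 x g).
Proof.
have [->//|xy] := eqVneq x y; apply/funext => eta; rewrite /mean1.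
under eq_bigr do rewrite mulr_sumr.
under [RHS]eq_bigr do rewrite mulr_sumr.
rewrite exchange_big/=; apply: eq_bigr => a _; apply: eq_bigr => c _.
rewrite mulrCA; congr (_ * (_ * g _)); apply/funext => z; rewrite /upd.
by case: eqP => // ->; case: eqP => // yx; rewrite yx eqxx in xy.
Qed.

Let mean_mean1 J x g : mean J (mean1 x g) = mean1 x (mean J g).
Proof. by elim: J => //= y J ->; rewrite mean1C. Qed.

Let meanC J K g : mean J (mean K g) = mean K (mean J g).
Proof. by elim: K => //= x K <-; exact: mean_mean1. Qed.

Let mean_uniq J K g : depends_on J g -> depends_on K g -> mean J g = mean K g.
Proof.
move=> gJ gK; have h L : depends_on L g -> depends_on [::] (mean L g).
  by move=> gL; apply: mean_dep; rewrite cats0.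
by rewrite -[LHS](mean_id K (h _ gJ)) meanC mean_id//; exact: h.
Qed.

Let mean_ge0 J g : (forall eta, 0 <= g eta) -> forall eta, 0 <= mean J g eta.
Proof.
move=> g0; elim: J => //= x J IH eta.
by apply: sumr_ge0 => a _; apply: mulr_ge0.
Qed.

Let meanD J g h : mean J (fun eta => g eta + h eta) =
  fun eta => mean J g eta + mean J h eta.
Proof.
elim: J => //= x J ->; apply/funext => eta; rewrite /mean1 -big_split/=.
by apply: eq_bigr => a _; rewrite mulrDr.
Qed.

Let meanZ J c g : mean J (fun eta => c * g eta) = fun eta => c * mean J g eta.
Proof.
elim: J => //= x J ->; apply/funext => eta; rewrite /mean1 mulr_sumr.
by apply: eq_bigr => a _; rewrite mulrCA.
Qed.

Let mean_elem J b : uniq J ->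
  mean J \1_(elem_cylinder J b) = fun=> \prod_(x <- J) p x (b x).
Proof.
elim: J => [_|x J IH /= /andP[xJ uJ]].
  by apply/funext => eta; rewrite big_nil/= indicE mem_set.
transitivity (fun eta => p x (b x) * mean J \1_(elem_cylinder J b) eta); last first.
  by rewrite IH//; apply/funext => eta; rewrite big_cons.
rewrite -mean_mean1 -meanZ; congr (mean J _); apply/funext => eta; rewrite /mean1.
rewrite (bigD1 (b x))//= big1 ?addr0.
  congr (_ * _); rewrite !indicE; congr ((nat_of_bool _)%:R); apply/idP/idP.
    rewrite !inE => h y yJ; have := h y; rewrite inE yJ orbT => /(_ isT).
    by rewrite /upd; case: eqP => // yx; rewrite -yx yJ in xJ.
  rewrite !inE => h y; rewrite inE /upd; case: eqP => [->//|_ /=]; exact: h.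
move=> a ab; rewrite indicE memNset ?mulr0// => /(_ x).
by rewrite inE eqxx /upd eqxx => /(_ isT) e; rewrite e eqxx in ab.
Qed.

Let support (S : set (config A)) := xget [::] [set J | depends_on J S].

Let weight (S : set (cylinder_alg A)) : \bar R :=
  (mean (support S) \1_S point)%:E.

Let indic_dep J S : depends_on J S -> depends_on J (\1_S : config A -> R).
Proof.
move=> SJ eta xi e; rewrite !indicE; congr ((nat_of_bool _)%:R).
by apply/idP/idP; rewrite !inE (SJ _ _ e).
Qed.

Let weightE J S : depends_on J S -> weight S = (mean J \1_S point)%:E.
Proof.
move=> SJ; congr (_ %:E).
rewrite (@mean_uniq _ J)//; last exact: indic_dep.
apply: indic_dep.
have /(xgetPex [::]) : exists J, [set J | depends_on J S] J by exists J.
by [].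
Qed.

Lemma product_law_exists : exists P : probability (config A) R,
  forall J b, uniq J ->
    P (elem_cylinder J b) = (\prod_(x <- J) p x (b x))%:E.
Proof.
have w1 : weight setT = 1%E.
  by rewrite (@weightE [::])//= indicT.
have w0 : weight set0 = 0%E.
  by rewrite (@weightE [::])//= indic0.
have wge0 S : (0 <= weight S)%E.
  by rewrite lee_fin; apply: mean_ge0 => eta; rewrite indicE ler0n.
have [|P PE] := cylinder_extension w0 wge0 _ w1.
  move=> S S' [J SJ] [K SK] SS'.
  have SJK := depends_on_catl (K := K) SJ.
  have SK' := depends_on_catr (J := J) SK.
  rewrite (weightE SJK) (weightE SK') (@weightE (J ++ K)); last first.
    by move=> eta xi e; rewrite /setU/= (SJK _ _ e) (SK' _ _ e).
  rewrite -EFinD; congr (_ %:E).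
  rewrite -[RHS](congr1 (@^~ point) (meanD _ _ _)).
  congr (mean _ _ _); apply/funext => eta; rewrite !indicE in_setU.
  case: (boolP (eta \in S)) => eS; case: (boolP (eta \in S')) => eS';
    rewrite /= ?addr0 ?add0r//.
  have : (S `&` S') eta by split; exact: set_mem.
  by rewrite SS'.
exists P => J b uJ; rewrite PE; last by exists J; exact: elem_cylinder_dep.
by rewrite (weightE (@elem_cylinder_dep _ _ _)) mean_elem.
Qed.

(* The law of a configuration with independent coordinates, the coordinate at
   [x] having law [p x]; by [product_lawE] and [eq_measure_elem_cylinder] below
   it is determined on measurable sets. *)
Definition product_law : probability (config A) R := sval (cid product_law_exists).

Lemma product_lawE J b : uniq J ->
  product_law (elem_cylinder J b) = (\prod_(x <- J) p x (b x))%:E.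
Proof. by rewrite /product_law; case: cid => P /=; exact. Qed.

End product_law.
Section cylinder_determining.
Variables (A : alphabetType) (R : realType).
Implicit Types (J : seq int) (S : set (config A)) (P Q : probability (config A) R).

Lemma eq_measure_cylinder P Q J S :
  (forall b, P (elem_cylinder J b) = Q (elem_cylinder J b)) ->
  depends_on J S -> P S = Q S.
Proof.
move=> PQ SJ.
pose F (f : {ffun seq_sub J -> A}) : set (config A) :=
  S `&` [set eta | forall i, eta (val i) = f i].
have FS : S = \bigcup_(f in setT) F f.
  apply/seteqP; split=> [eta Seta|eta [f _ []]//].
  exists [ffun i => eta (val i) : A] => //; split => // i.
  by rewrite ffunE.
have FJ f : depends_on J (F f).
  move=> eta xi e; rewrite /F/setI/= (SJ _ _ e); apply/propext.
  by split=> -[? h]; split=> // i; rewrite -h e// ?(valP i).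
have tF : trivIset setT F.
  move=> f g _ _ [eta [[_ ef] [_ eg]]]; apply/ffunP => i.
  by rewrite -ef -eg.
have PF (M : probability (config A) R) : M S = (\sum_(f \in setT) M (F f))%E.
  rewrite {1}FS measure_fin_bigcup//; first exact: finite_finset.
  by move=> f _; apply: measurable_cylinder; exists J.
rewrite !PF; apply: eq_fsbigr => f _.
have [->|/set0P[eta Feta]] := eqVneq (F f) set0; first by rewrite !measure0.
suff -> : F f = elem_cylinder J eta by exact: PQ.
case: Feta => Seta fE; apply/seteqP; split=> xi.
  by move=> [_ h] x xJ; have := h (SeqSub xJ); rewrite -fE.
move=> e; split; first by rewrite (SJ _ _ e).
by move=> i; rewrite e ?fE// (valP i).
Qed.

Lemma eq_measure_elem_cylinder P Q :
  (forall J b, uniq J -> P (elem_cylinder J b) = Q (elem_cylinder J b)) ->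
  P ≡μ Q.
Proof.
move=> PQ S mS.
apply: (measure_unique (@cylinder A) (fun=> setT)) => //.
- exact: cylinderI.
- by move=> _; exists [::].
- by rewrite bigcup_const.
- move=> T [J TJ]; apply: (@eq_measure_cylinder _ _ (undup J)).
    by move=> b; exact: PQ (undup_uniq J).
  by apply: depends_on_sub TJ => x; rewrite mem_undup.
- by move=> _; apply: (@le_lt_trans _ _ 1%E); rewrite ?ltry// probability_le1.
Qed.

Lemma depends_on_measurable d (T : measurableType d) J (g : config A -> T) :
  depends_on J g -> measurable_fun setT g.
Proof.
move=> gJ _ B mB; rewrite setTI; apply: measurable_cylinder.
by exists J => eta xi e; rewrite /preimage/= (gJ _ _ e).
Qed.

End cylinder_determining.

(* [pca_rule F a b] is the probability of the symbol [b] when the neighbourhood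
   [x + y_1, ..., x + y_m] of the updated site [x] carries [a]. *)
Record pca (R : realType) (A : alphabetType) := Pca {
  pca_size : nat;
  pca_nbhd : pca_size.-tuple int;
  pca_rule : pca_size.-tuple A -> A -> R;
  pca_nbhd_uniq : uniq pca_nbhd;
  pca_rule_ge0 : forall a b, 0 <= pca_rule a b;
  pca_rule_sum1 : forall a, \sum_b pca_rule a b = 1
}.

Arguments pca_rule {R A} p.

Section pca_step.
Variables (R : realType) (A : alphabetType) (F : pca R A).
Implicit Types (eta : config A) (mu nu : probability (config A) R).

Definition pca_local eta (x : int) (b : A) : R :=
  pca_rule F [tuple (eta (x + tnth (pca_nbhd F) i) : A) | i < pca_size F] b.

Lemma pca_local_ge0 eta x b : 0 <= pca_local eta x b.
Proof. exact: pca_rule_ge0. Qed.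

Lemma pca_local_sum1 eta x : \sum_b pca_local eta x b = 1.
Proof. exact: pca_rule_sum1. Qed.

(* The law of the random configuration [F eta] for a fixed [eta]. *)
Definition pca_image eta : probability (config A) R :=
  product_law (pca_local_ge0 eta) (pca_local_sum1 eta).

Lemma pca_imageE eta (J : seq int) (b : config A) : uniq J ->
  pca_image eta (elem_cylinder J b) = (\prod_(x <- J) pca_local eta x (b x))%:E.
Proof. exact: product_lawE. Qed.

Lemma measurable_pca_image (S : set (config A)) : measurable S ->
  measurable_fun [set: config A] (pca_image ^~ S).
Proof.
move: S; apply: (@dynkin_induction _ _ (@cylinder A)) => //.
- exact: cylinderI.
- by apply: eq_measurable_fun (measurable_cst 1%E) => eta _; rewrite probability_setT.
- move=> S [J0 SJ0]; pose J := undup J0.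
  have SJ : depends_on J S.
    by apply: depends_on_sub SJ0 => x; rewrite mem_undup.
  apply: (@depends_on_measurable _ _ _ [seq x + y | x <- J, y <- pca_nbhd F]).
  move=> eta xi e; apply: (eq_measure_cylinder _ SJ) => b.
  rewrite !pca_imageE ?undup_uniq//; congr (_ %:E).
  apply: eq_big_seq => x xJ; congr (pca_rule F _ _); apply: eq_from_tnth => i.
  by rewrite !tnth_mktuple; apply: e; apply: allpairs_f => //; exact: mem_tnth.
- move=> S mS h; apply: (eq_measurable_fun (fun eta => 1 - pca_image eta S)%E).
    by move=> eta _; rewrite probability_setC.
  exact: emeasurable_funB.
- move=> S mS tS h.
  apply: (eq_measurable_fun (fun eta => \sum_(n <oo) pca_image eta (S n))%E).
    by move=> eta _; rewrite measure_semi_bigcup//; exact: bigcupT_measurable.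
  by apply: ge0_emeasurable_sum.
Qed.

Section pushforward.
Variable mu : probability (config A) R.
Local Open Scope ereal_scope.

Definition pca_push (S : set (config A)) : \bar R :=
  \int[mu]_eta pca_image eta S.

Let pca_push0 : pca_push set0 = 0.
Proof. by rewrite /pca_push integral0_eq// => eta _; rewrite measure0. Qed.

Let pca_push_ge0 S : 0 <= pca_push S.
Proof. exact: integral_ge0. Qed.

Let pca_push_sigma_additive : semi_sigma_additive pca_push.
Proof.
move=> S mS tS mUS; rewrite [X in _ --> X](_ : _ =
    \int[mu]_eta \sum_(n <oo) pca_image eta (S n)); last first.
  by apply: eq_integral => eta _; rewrite measure_semi_bigcup.
rewrite integral_nneseries//; last by move=> n; exact: measurable_pca_image.
by apply: is_cvg_nneseries => n _ _; exact: pca_push_ge0.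
Qed.

HB.instance Definition _ := isMeasure.Build _ _ R pca_push
  pca_push0 pca_push_ge0 pca_push_sigma_additive.

Let pca_push_setT : pca_push setT = 1.
Proof.
rewrite /pca_push (eq_integral (cst 1)); last first.
  by move=> eta _; exact: probability_setT.
by rewrite integral_cst// mul1e; exact: probability_setT.
Qed.

HB.instance Definition _ := Measure_isProbability.Build _ _ R pca_push
  pca_push_setT.

End pushforward.

Definition pca_step mu : probability (config A) R := pca_push mu.

Lemma pca_stepE mu (J : seq int) (b : config A) : uniq J ->
  pca_step mu (elem_cylinder J b) =
  (\int[mu]_eta (\prod_(x <- J) pca_local eta x (b x))%:E)%E.
Proof. by move=> uJ; apply: eq_integral => eta _; exact: pca_imageE. Qed.

End pca_step.
(* A [probability] is a function on all sets, including non-measurable ones, so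
   equality of laws is [≡μ] (equality on measurable sets), not Leibniz equality. *)
Definition pca_stationary (R : realType) (A : alphabetType) (F : pca R A)
    (mu : probability (config A) R) :=
  pca_step F mu ≡μ mu.

Definition weak_cvg (R : realType) (A : alphabetType)
    (mu_ : nat -> probability (config A) R) (mu : probability (config A) R) :=
  forall f : config A -> R, continuous f -> [bounded f eta | eta in setT] ->
    (\int[mu_ t]_eta (f eta)%:E)%E @[t --> \oo] --> (\int[mu]_eta (f eta)%:E)%E.

Definition pca_ergodic (R : realType) (A : alphabetType) (F : pca R A) :=
  exists mu : probability (config A) R,
    [/\ pca_stationary F mu,
        (forall nu, pca_stationary F nu -> nu ≡μ mu) &
        (forall nu, weak_cvg (fun t => iter t (pca_step F) nu) mu)].

Section Fpq.
Variables (R : realType) (p q : R).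
Hypotheses (p01 : 0 <= p <= 1) (q01 : 0 <= q <= 1).

(* The alphabet {0, 1} is [bool], with [false] for 0 and [true] for 1. *)
Definition rule_pq (a : 3.-tuple bool) (b : bool) : R :=
  if a == [tuple false; false; false] then (if b then 1 - p else p)
  else (if b then q else 1 - q).

Let rule_pq_ge0 a b : 0 <= rule_pq a b.
Proof.
by rewrite /rule_pq; case: ifP; case: b; rewrite ?subr_ge0;
  case/andP: p01; case/andP: q01.
Qed.

Let rule_pq_sum1 a : \sum_b rule_pq a b = 1.
Proof.
by rewrite big_bool/= /rule_pq; case: ifP; rewrite ?subrK// addrC subrK.
Qed.

Let nbhd_uniq : uniq [tuple 0; 1; 2 : int].
Proof. by []. Qed.

Definition pca_pq : pca R bool := Pca nbhd_uniq rule_pq_ge0 rule_pq_sum1.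

End Fpq.

(* Main.v *)
Require Import Defs.
From mathcomp Require Import all_boot all_order all_algebra.
From mathcomp Require Import all_classical all_reals all_analysis.
From mathcomp Require Import measurable_realfun giry.
From mathcomp Require Import ring lra zify.
Set Implicit Arguments.
Unset Strict Implicit.
Unset Printing Implicit Defensive.
Import Order.TTheory GRing.Theory Num.Theory.
Import numFieldNormedType.Exports.
Local Open Scope classical_set_scope.
Local Open Scope ring_scope.

(**
Because p + q <= 1, one step of F_{p,q} puts 0 with probability p, 1 with
probability q and the NOR of the three neighbours otherwise. Allowing a third
symbol ? for an unknown value (NOR is ? when no neighbour is 1 but some is ?)
gives an envelope PCA; started from ? everywhere, it dominates the discrepancy
between any two trajectories, so everything reduces to showing that the density
mu_t(?) of ? at time t tends to 0. The law mu_t is invariant under shifts and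
under reflection, and with r = 1 - p - q and d = r^2 p (2 + 6 p) the functional
  mu(?) + mu(0?) + mu(00?) + mu(10?) + 2 mu(100?) + d mu(000?)
decreases at each step by at least a positive multiple of mu_t(?), so that
mu_t(?) is even summable in t. Forgetting of the initial condition then makes
all cylinder probabilities converge, to the same limits for all initial laws,
and these limits define the stationary measure.
*)

(** * One step of a PCA with three neighbours, on finite words *)

Section word_kernel.
Variables (R : realFieldType) (S : finType) (phi : S -> S -> S -> S -> R).
Implicit Types (G H : seq S -> R) (v w : seq S) (a b c x : S).

(** An expectation operator: the mean of [G] over the random image of [v], two letters shorter, its
    letters drawn independently from left to right. A word of fewer than three letters has empty
    image. Iterating acts on observables, backwards in time. *)
Fixpoint word_step G v {struct v} : R :=
  match v with
  | a :: ((b :: c :: _) as v') =>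
      \sum_x phi a b c x * word_step (fun w => G (x :: w)) v'
  | _ => G [::]
  end.

Arguments word_step : simpl never.

Lemma word_step_cons G a b c v : word_step G [:: a, b, c & v] =
  \sum_x phi a b c x * word_step (fun w => G (x :: w)) [:: b, c & v].
Proof. by []. Qed.

Lemma eq_word_step G H v : (forall w, size w = (size v - 2)%N -> G w = H w) ->
  word_step G v = word_step H v.
Proof.
elim: v G H => [|a v IH] G H GH; first exact: GH.
case: v IH GH => [|b [|c v]] IH GH; [exact: GH..|].
rewrite !word_step_cons; apply: eq_bigr => x _; congr (_ * _).
by apply: IH => w; rewrite /= subn2 => sw; apply: GH; rewrite /= sw subn2.
Qed.

Lemma word_stepD G H v :
  word_step (fun w => G w + H w) v = word_step G v + word_step H v.
Proof.
elim: v G H => [|a [|b [|c v]] IH] G H //.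
by rewrite !word_step_cons -big_split/=; apply: eq_bigr => x _;
rewrite -mulrDr -IH.
Qed.

Lemma word_stepZ k G v : word_step (fun w => k * G w) v = k * word_step G v.
Proof.
elim: v G => [|a [|b [|c v]] IH] G //.
by rewrite !word_step_cons mulr_sumr; apply: eq_bigr => x _;
rewrite mulrCA -IH.
Qed.

(** The recursion seen from the right end; for a symmetric rule it yields reflection invariance. *)
Lemma word_step_rcons G v a b c : word_step G (v ++ [:: a; b; c]) =
  \sum_x phi a b c x * word_step (fun w => G (rcons w x)) (v ++ [:: a; b]).
Proof.
elim: v G => [|d v IH] G; first by [].
have -> : (d :: v) ++ [:: a; b; c] = d :: (v ++ [:: a; b; c]) by [].
have -> : (d :: v) ++ [:: a; b] = d :: (v ++ [:: a; b]) by [].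
(* Exposing two leading letters lets [word_step_cons] fire on both words. *)
have [e [f [v' [E1 E2]]]] : exists e f v', v ++ [:: a; b] = [:: e, f & v'] /\
    v ++ [:: a; b; c] = [:: e, f & rcons v' c].
  case: v {IH} => [|e [|f v]]; first by exists a, b, [::].
    by exists e, a, [:: b].
  by exists e, f, (v ++ [:: a; b]); split => //=; rewrite rcons_cat.
rewrite E2 E1 !word_step_cons -E1 -E2.
under eq_bigr => x _ do rewrite IH mulr_sumr.
rewrite exchange_big/=; apply: eq_bigr => x _.
by rewrite E1 word_step_cons -E1 mulr_sumr; apply: eq_bigr => y _; rewrite mulrCA.
Qed.

Hypothesis phi_sym : forall a b c x, phi a b c x = phi c b a x.

Lemma word_step_rev G v : word_step (fun w => G (rev w)) (rev v) = word_step G v.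
Proof.
elim: v G => [|a v IH] G //.
case: v IH => [|b [|c v]] IH //.
rewrite word_step_cons.
have -> : rev [:: a, b, c & v] = rev v ++ [:: c; b; a].
  by rewrite !rev_cons -!cats1 -!catA.
rewrite word_step_rcons; apply: eq_bigr => x _; rewrite phi_sym; congr (_ * _).
rewrite -IH !rev_cons -!cats1 -!catA.
by apply: eq_word_step => w _; rewrite rev_rcons.
Qed.

Hypothesis phi_sum1 : forall a b c, \sum_x phi a b c x = 1.

(** Summing out the first new letter leaves the step on the tail; this is the source of shift
    invariance. *)
Lemma word_step_behead G v : (2 < size v)%N ->
  word_step (fun w => G (behead w)) v = word_step G (behead v).
Proof.
case: v => [|a [|b [|c v]]] // _.
by rewrite word_step_cons /= -mulr_suml phi_sum1 mul1r.
Qed.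

Hypothesis phi_ge0 : forall a b c x, 0 <= phi a b c x.

Lemma le_word_step G H v : (forall w, size w = (size v - 2)%N -> G w <= H w) ->
  word_step G v <= word_step H v.
Proof.
elim: v G H => [|a v IH] G H GH; first exact: GH.
case: v IH GH => [|b [|c v]] IH GH; [exact: GH..|].
rewrite !word_step_cons; apply: ler_sum => x _; apply: ler_wpM2l => //.
by apply: IH => w; rewrite /= subn2 => sw; apply: GH; rewrite /= sw subn2.
Qed.

Lemma le_word_iter t G H v : (forall w, size w = (size v - t.*2)%N -> G w <= H w) ->
  iter t word_step G v <= iter t word_step H v.
Proof.
elim: t v => [|t IH] v GH; first by apply: GH; rewrite subn0.
rewrite !iterS; apply: le_word_step => w sw; apply: IH => u su; apply: GH.
by rewrite su sw -subnDA doubleS.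
Qed.

Lemma word_iterD t G H v : iter t word_step (fun w => G w + H w) v =
  iter t word_step G v + iter t word_step H v.
Proof.
elim: t v => [//|t IH] v; rewrite !iterS -word_stepD.
by apply: eq_word_step => w _; rewrite IH.
Qed.

Lemma word_iterZ t k G v :
  iter t word_step (fun w => k * G w) v = k * iter t word_step G v.
Proof.
elim: t v => [//|t IH] v; rewrite !iterS -word_stepZ.
by apply: eq_word_step => w _; rewrite IH.
Qed.

Lemma word_iter_rev t G v :
  iter t word_step (fun w => G (rev w)) (rev v) = iter t word_step G v.
Proof.
elim: t v => [|t IH] v; first by rewrite /= revK.
rewrite !iterS -[RHS](word_step_rev (iter t word_step G)).
by apply: eq_word_step => w _; rewrite -IH revK.
Qed.

Lemma word_iter_behead t G v : (t.*2 < size v)%N ->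
  iter t word_step (fun w => G (behead w)) v = iter t word_step G (behead v).
Proof.
elim: t v => [//|t IH] v; rewrite doubleS => tv /=.
rewrite -word_step_behead; last by apply: leq_trans tv.
by apply: eq_word_step => w sw; rewrite IH// sw ltn_subRL addnC addn2.
Qed.

End word_kernel.

Arguments word_step : simpl never.

(** * The envelope automaton *)

Section envelope.
Variable R : realFieldType.
Implicit Types (a b c x : option bool) (v w : seq (option bool)).

Lemma big_option_bool (F : option bool -> R) :
  \sum_x F x = F None + F (Some true) + F (Some false).
Proof.
rewrite (bigD1 None)//= (bigD1 (Some true))//= (bigD1 (Some false))//=.
by rewrite big1 ?addr0 ?addrA// => -[[]|].
Qed.

(* The letter [?] is [None]. *)
Definition nor3 a b c : option bool :=
  if Some true \in [:: a; b; c] then Some false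
  else if None \in [:: a; b; c] then None else Some true.

Variables p q : R.

Definition envelope_rule a b c x : R :=
  match x with None => 0 | Some true => q | Some false => p end +
  (1 - p - q) * (x == nor3 a b c)%:R.

Lemma envelope_rule_sum1 a b c : \sum_x envelope_rule a b c x = 1.
Proof.
rewrite big_option_bool /envelope_rule; case: (nor3 a b c) => [[]|] /=; ring.
Qed.

Lemma envelope_rule_sym a b c x : envelope_rule a b c x = envelope_rule c b a x.
Proof.
by rewrite /envelope_rule /nor3 !inE; do !congr (_ + _ * (_ == _)%:R);
  case: a b c => [[]|] [[]|] [[]|].
Qed.

Hypotheses (p0 : 0 <= p) (q0 : 0 <= q) (pq1 : p + q <= 1).

Lemma envelope_rule_ge0 a b c x : 0 <= envelope_rule a b c x.
Proof.
apply: addr_ge0; first by case: x => [[]|].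
by apply: mulr_ge0; rewrite ?ler0n//; move: pq1; lra.
Qed.

Local Notation T := (word_step envelope_rule).

(* The mean, at time [t], of [G] over [n] consecutive sites of the envelope
   automaton started from [?] everywhere. *)
Definition unknown_mean t n (G : seq (option bool) -> R) : R :=
  iter t T G (nseq (n + t.*2) None).

Lemma unknown_meanS t n G : unknown_mean t.+1 n G = unknown_mean t n.+2 (T G).
Proof. by rewrite /unknown_mean iterSr doubleS !addnS !addSn. Qed.

Lemma le_unknown_mean t n G H : (forall w, size w = n -> G w <= H w) ->
  unknown_mean t n G <= unknown_mean t n H.
Proof.
move=> GH; apply: le_word_iter; first exact: envelope_rule_ge0.
by move=> w; rewrite size_nseq addnK; exact: GH.
Qed.

Lemma eq_unknown_mean t n G H : (forall w, size w = n -> G w = H w) ->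
  unknown_mean t n G = unknown_mean t n H.
Proof.
by move=> GH; apply/eqP; rewrite eq_le !le_unknown_mean// => w sw; rewrite GH.
Qed.

Lemma unknown_meanD t n G H : unknown_mean t n (fun w => G w + H w) =
  unknown_mean t n G + unknown_mean t n H.
Proof. by rewrite /unknown_mean word_iterD//; exact: envelope_rule_ge0. Qed.

Lemma unknown_meanZ t n k G :
  unknown_mean t n (fun w => k * G w) = k * unknown_mean t n G.
Proof. by rewrite /unknown_mean word_iterZ//; exact: envelope_rule_ge0. Qed.

Lemma unknown_meanB t n G H : unknown_mean t n (fun w => G w - H w) =
  unknown_mean t n G - unknown_mean t n H.
Proof.
rewrite -[in RHS]mulN1r -unknown_meanZ -unknown_meanD.
by apply: eq_unknown_mean => w _; rewrite mulN1r.
Qed.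

Lemma unknown_mean_behead t n G :
  unknown_mean t n.+1 (fun w => G (behead w)) = unknown_mean t n G.
Proof.
rewrite /unknown_mean word_iter_behead//.
- exact: envelope_rule_sum1.
- by rewrite size_nseq addSn ltnS leq_addl.
Qed.

Lemma unknown_mean_rev t n G :
  unknown_mean t n (fun w => G (rev w)) = unknown_mean t n G.
Proof.
rewrite /unknown_mean -[RHS]word_iter_rev ?rev_nseq//.
exact: envelope_rule_sym.
Qed.

(** Predicates instead of letters allow wildcards and the class of letters other than 1. *)
Definition pattern_mass t (l : seq (pred (option bool))) : R :=
  unknown_mean t (size l) (fun w => (all2 (fun P : pred (option bool) => P) l w)%:R).

Lemma mass_ge0 t l : 0 <= pattern_mass t l.
Proof.
rewrite -(mul0r (unknown_mean t (size l) (fun=> 1))) -unknown_meanZ.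
by apply: le_unknown_mean => w _; rewrite mul0r ler0n.
Qed.

Lemma mass_consT t l : pattern_mass t (xpredT :: l) = pattern_mass t l.
Proof.
rewrite /pattern_mass /= -[RHS]unknown_mean_behead; apply: eq_unknown_mean.
by case.
Qed.

Lemma mass_rev t l : pattern_mass t (rev l) = pattern_mass t l.
Proof.
rewrite /pattern_mass -[RHS]unknown_mean_rev size_rev; apply: eq_unknown_mean => w sw.
congr (nat_of_bool _)%:R; rewrite !all2E !size_rev sw eqxx /=.
by rewrite -[in LHS](revK w) -rev_zip ?all_rev ?size_rev.
Qed.

Lemma mass_rconsT t l : pattern_mass t (rcons l xpredT) = pattern_mass t l.
Proof. by rewrite -mass_rev rev_rcons mass_consT mass_rev. Qed.

Lemma mass_split t (P P1 P2 : pred (option bool)) l1 l2 :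
  (forall x, P x = P1 x + P2 x :> nat)%N ->
  pattern_mass t (l1 ++ P :: l2) =
  pattern_mass t (l1 ++ P1 :: l2) + pattern_mass t (l1 ++ P2 :: l2).
Proof.
move=> PE; rewrite /pattern_mass !size_cat/= -unknown_meanD; apply: eq_unknown_mean.
move=> w sw; rewrite -natrD; congr _%:R.
elim: l1 w sw => [|P' l1 IH] [|x w]//= [sw].
  by have := PE x; case: (all2 _ l2 w); case: (P x); case: (P1 x); case: (P2 x).
by have := IH w sw; case: (P' x).
Qed.

Lemma le_mass t l l' : pattern_mass t (l ++ l') <= pattern_mass t l.
Proof.
elim/last_ind: l' => [|l' P IH]; first by rewrite cats0.
apply: le_trans IH; rewrite -rcons_cat -[leRHS]mass_rconsT.
rewrite -!cats1 (@mass_split t xpredT P (predC P))// ?lerDl ?mass_ge0//.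
by move=> x /=; case: (P x).
Qed.

Definition unknown_mass t : R := pattern_mass t [:: pred1 None : pred (option bool)].

(** By shift invariance every site is [?] with the same probability, so linearity of the mean
    suffices. *)
Lemma unknown_mean_count t n :
  unknown_mean t n (fun w => (count (pred1 None) w)%:R) <= n%:R * unknown_mass t.
Proof.
elim: n => [|n IH].
  (* The zero function is written [0 * 0] so that [unknown_meanZ] evaluates its mean. *)
  rewrite mul0r; apply: le_trans (_ : unknown_mean t 0 (fun=> 0 * 0) <= _).
    by apply: le_unknown_mean => -[|//] _; rewrite mul0r.
  by rewrite unknown_meanZ mul0r.
rewrite -add1n natrD mulrDl mul1r; apply: le_trans (lerD _ IH); last first.
  exact: (le_mass t [:: pred1 None : pred (option bool)] (nseq n xpredT)).
rewrite /pattern_mass /= size_nseq -[X in _ + X]unknown_mean_behead -unknown_meanD.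
apply: le_unknown_mean => -[//|x w] [sw] /=.
rewrite -natrD ler_nat leq_add2r; case: (x == None) => //=.
by elim: w n {IH} sw => [|y w IH] [|n]//= [/IH].
Qed.

End envelope.

(** * Domination of discrepancies by the envelope *)

Section coupling.
Variables (R : realFieldType) (p q : R).
Hypotheses (p0 : 0 <= p) (q0 : 0 <= q) (pq1 : p + q <= 1).

(** This is [rule_pq] rewritten as noise of masses [p] and [q] plus NOR with the remaining mass;
    [pca_localE] proves the agreement. *)
Definition nor_rule (a b c x : bool) : R :=
  (if x then q else p) + (1 - p - q) * (x == ~~ [|| a, b | c])%:R.

Definition compatible (x : option bool) (b : bool) := if x is Some y then y == b else true.

Lemma nor3_compatible a b c x y z : compatible x a -> compatible y b -> compatible z c ->
  compatible (nor3 x y z) (~~ [|| a, b | c]).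
Proof. by case: x y z a b c => [[]|] [[]|] [[]|] [] [] []. Qed.

(** The words [v], [v'] and the envelope word [u] above both are updated with the same randomness.
    Two observables [G], [G'] are needed since the induction may prefix different letters to
    them. *)
Lemma coupling_step (G G' : seq bool -> R) (E : seq (option bool) -> R) v v' u :
  (forall w w' s, all2 compatible s w -> all2 compatible s w' -> G w - G' w' <= E s) ->
  all2 compatible u v -> all2 compatible u v' ->
  word_step nor_rule G v - word_step nor_rule G' v' <=
  word_step (envelope_rule p q) E u.
Proof.
elim: u v v' G G' E => [|x [|y [|z u]] IH] [|a [|b [|c v]]] [|a' [|b' [|c' v']]] //=
  G G' E GE; do ?[by move=> *; exact: GE | by rewrite ?andbF].
move=> /and4P[xa yb zc uv] /and4P[xa' yb' zc' uv'].
rewrite !word_step_cons !big_bool big_option_bool.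
set g1 := word_step _ (fun w => G (true :: w)) _.
set g0 := word_step _ (fun w => G (false :: w)) _.
set g1' := word_step _ (fun w => G' (true :: w)) _.
set g0' := word_step _ (fun w => G' (false :: w)) _.
set e := word_step _ (fun w => E (None :: w)) _.
set e1 := word_step _ (fun w => E (Some true :: w)) _.
set e0 := word_step _ (fun w => E (Some false :: w)) _.
have GEx k k' s : compatible s k -> compatible s k' ->
    word_step nor_rule (fun w => G (k :: w)) [:: b, c & v] -
    word_step nor_rule (fun w => G' (k' :: w)) [:: b', c' & v'] <=
    word_step (envelope_rule p q) (fun w => E (s :: w)) [:: y, z & u].
  move=> sk sk'; apply: IH; rewrite /= ?yb ?zc ?yb' ?zc' //.
  by move=> w w' l lw lw'; apply: GE; rewrite /= ?sk ?sk'.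
(* The cases of the shared randomness: all write 1, all write 0, or each applies its NOR, where
   [nor3_compatible] preserves compatibility. *)
have h1 : g1 - g1' <= e1 by exact: GEx.
have h0 : g0 - g0' <= e0 by exact: GEx.
have r0 : 0 <= 1 - p - q by move: pq1; lra.
have n1 := nor3_compatible xa yb zc; have n2 := nor3_compatible xa' yb' zc'.
have := ler_wpM2l r0 (GEx _ _ _ n1 n2).
have := ler_wpM2l q0 h1; have := ler_wpM2l p0 h0.
rewrite /nor_rule /envelope_rule.
case: (~~ [|| a, b | c]); case: (~~ [|| a', b' | c']); case: (nor3 x y z) => [[]|];
  rewrite -/g1 -/g0 -/g1' -/g0' -/e -/e1 -/e0 /=; lra.
Qed.

Lemma coupling_iter t (G G' : seq bool -> R) (E : seq (option bool) -> R) v v' u :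
  (forall w w' s, all2 compatible s w -> all2 compatible s w' -> G w - G' w' <= E s) ->
  all2 compatible u v -> all2 compatible u v' ->
  iter t (word_step nor_rule) G v - iter t (word_step nor_rule) G' v' <=
  iter t (word_step (envelope_rule p q)) E u.
Proof.
move=> GE; elim: t v v' u => [|t IH] v v' u; first exact: GE.
by rewrite !iterS; exact: coupling_step.
Qed.

(** The all-[?] word lies above every word. At time [t], if the envelope shows no [?] then both
    words agree; otherwise the difference is at most [B], hence at most [B] times the number of
    [?]. *)
Lemma word_iter_osc t n B (G : seq bool -> R) v v' : 0 <= B ->
  (forall w w', G w - G w' <= B) ->
  size v = (n + t.*2)%N -> size v' = (n + t.*2)%N ->
  iter t (word_step nor_rule) G v - iter t (word_step nor_rule) G v' <=
  B * (n%:R * unknown_mass p q t).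
Proof.
move=> B0 GB sv sv'.
have all_compat w m : size w = m -> all2 compatible (nseq m None) w.
  by elim: w m => [|x w IH] [|m]//= [/IH].
apply: le_trans (ler_wpM2l B0 (unknown_mean_count p0 q0 pq1 t n)).
rewrite -unknown_meanZ//; apply: coupling_iter; [|exact: all_compat..].
move=> w w' s sw sw'; have [s0|s0] := posnP (count (pred1 None) s); last first.
  by apply: (le_trans (GB _ _)); rewrite ler_peMr// ler1n.
suff -> : w = w' by rewrite subrr mulr_ge0 ?ler0n.
elim: s w w' sw sw' s0 => [|[x|] s IH] [|a w] [|a' w']//=.
by move=> /andP[/eqP <- sw] /andP[/eqP <- sw']; rewrite add0n => /(IH _ _ sw sw') ->.
Qed.

End coupling.

(** * Decay of the density of [?] *)

Section decay.
Variables (R : realFieldType) (p q : R).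
Hypotheses (p0 : 0 <= p) (q0 : 0 <= q) (pq1 : p + q <= 1).

Let r := 1 - p - q.
Let s := p + r.
Let e := r ^+ 2 * p.
Let d := e * (2 + 6 * p).

(* Mean weight of an updated site known to be [?], when the three sites on its
   left become 0 with probabilities [c0], [c1], [c2] and 1 with probability q:
   a site becomes 0 with probability [s] if it has a neighbour 1, [p] if not. *)
Let weight c0 c1 c2 := 1 + c2 + c1 * c2 + q * c2 + 2 * q * c1 * c2 + d * c0 * c1 * c2.

(* The contribution of a new [?] to the weight: [lam] when no 1 precedes it
   closely, with an excess [chi], [y] or [z] when the nearest 1 is adjacent to,
   one site before, or two sites before its neighbourhood. *)
Let lam := r * weight p p p.
Let chi := r * (weight s s s - weight p p p).
Let y := r * (weight s s p - weight p p p).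
Let z := r * (weight s p p - weight p p p).

(** * Inequalities between the coefficients *)

Let r0 : 0 <= r. Proof. by rewrite /r; move: pq1; lra. Qed.
Let e0 : 0 <= e. Proof. by rewrite mulr_ge0// exprn_ge0. Qed.
Let d0 : 0 <= d. Proof. by rewrite mulr_ge0//; move: p0; lra. Qed.
Let p1 : p <= 1. Proof. by move: q0 pq1; lra. Qed.

(** Since [d] equals [2 * p * (r ^+ 2 * (1 + 3 * p))], this is the basic bound on [d]. After
    [r <= 1 - p] the gap is [3 * p ^+ 2 * (1 - p)]. *)
Let r2_le : r ^+ 2 * (1 + 3 * p) <= 1 + p - 2 * p ^+ 2.
Proof.
have r1 : r ^+ 2 <= (1 - p) ^+ 2.
  by rewrite lerXn2r ?nnegrE// ?subr_ge0// /r; move: q0; lra.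
apply: (@le_trans _ _ ((1 - p) ^+ 2 * (1 + 3 * p))).
  by apply: ler_wpM2r => //; move: p0; lra.
have := mulr_ge0 (exprn_ge0 2 p0) (_ : 0 <= 1 - p); rewrite subr_ge0 p1 => /(_ isT).
lra.
Qed.

Let d_le2 : d <= 2.
Proof.
have := ler_wpM2l p0 r2_le; rewrite /d /e.
have := mulr_ge0 (sqr_ge0 (1 - p)) (_ : 0 <= 1 + p).
have := exprn_ge0 3 p0; move: p0; lra.
Qed.

Let rp1 : r + p <= 1. Proof. by rewrite /r; move: q0; lra. Qed.

Let rp_le : 4 * (r * p) <= 1.
Proof.
have : (r + p) ^+ 2 <= 1 by rewrite expr_le1// addr_ge0.
have := sqr_ge0 (r - p); lra.
Qed.

Let rd_lt1 : r * d < 1.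
Proof.
have : 0 <= r * p * (2 * (1 + p - 2 * p ^+ 2 - r ^+ 2 * (1 + 3 * p))).
  by rewrite !mulr_ge0// subr_ge0.
have rp0 : 0 <= r * p by rewrite mulr_ge0.
(* The maximum of [1 + p - 2 * p ^+ 2] is 9/8, at [p = 1/4]; with [rp_le] this gives
   [r * d <= 9/16]. *)
have : r * p * (4 * (1 + p - 2 * p ^+ 2)) <= r * p * (9 / 2).
  by apply: ler_wpM2l => //; have := sqr_ge0 (4 * p - 1); lra.
by move: rp_le; rewrite /d /e; lra.
Qed.

(** The defect [1 - lam] is the rate of decay. The first term keeps it positive when [q = 0], the
    second when [q > 0]. *)
Let lam_defect :
  1 - lam = p ^+ 3 * (1 - r * d) + q * (1 + p * (1 - r) + p ^+ 2 * (1 - 2 * r)).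
Proof. by rewrite /lam /weight /r; ring. Qed.

Let s0 : 0 <= s. Proof. exact: addr_ge0. Qed.

Let y_ge0 : 0 <= y.
Proof.
rewrite (_ : y = e * (1 + 2 * q + d * (s + p))); last first.
  by rewrite /y /weight /s /e; ring.
apply: mulr_ge0 => //; apply: addr_ge0; first by move: q0; lra.
by apply: mulr_ge0 => //; exact: addr_ge0.
Qed.

Let zE : z = e * p * d.
Proof. by rewrite /z /weight /s /e; ring. Qed.

Let z_ge0 : 0 <= z.
Proof. by rewrite zE; apply: mulr_ge0 => //; exact: mulr_ge0. Qed.

Let z_le : z <= 2 * (e * p).
Proof. by rewrite zE mulrC; apply: ler_wpM2r => //; exact: mulr_ge0. Qed.

Let chi_ge0 : 0 <= chi.
Proof.
rewrite (_ : chi = r ^+ 2 * (1 + q + (1 + 2 * q) * (s + p) +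
    d * (s ^+ 2 + s * p + p ^+ 2))); last first.
  by rewrite /chi /weight /s; ring.
have q2 : 0 <= 1 + 2 * q by move: q0; lra.
apply: mulr_ge0; first exact: exprn_ge0.
apply: addr_ge0; first apply: addr_ge0; first by move: q0; lra.
  by rewrite mulr_ge0// addr_ge0.
by rewrite mulr_ge0// !addr_ge0 ?mulr_ge0 ?exprn_ge0.
Qed.

Let q_le : q * (1 - 2 * (r * p ^+ 2)) <= 1 - lam.
Proof.
rewrite lam_defect ler_wpDl//; first by rewrite mulr_ge0 ?exprn_ge0// subr_ge0 ltW.
apply: ler_wpM2l => //.
have : 0 <= p * (1 - r) by rewrite mulr_ge0// subr_ge0; move: p0 rp1; lra.
have := exprn_ge0 2 p0; lra.
Qed.

Let lam_lt1 : 0 < p + q -> lam < 1.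
Proof.
move=> pq0; rewrite -subr_gt0.
have [q_eq0|q_neq0] := eqVneq q 0; last first.
  apply: lt_le_trans q_le; apply: mulr_gt0; first by rewrite lt_def q_neq0.
  have : r * p * p <= r * p by rewrite ler_piMr// mulr_ge0.
  by move: rp_le; lra.
have pp : 0 < p by move: pq0; rewrite q_eq0 addr0.
rewrite lam_defect q_eq0 mul0r addr0; apply: mulr_gt0; first exact: exprn_gt0.
by rewrite subr_gt0.
Qed.

(** As [d * (s + 2 * p) <= 4 * p], the excess over [e * (1 + 4 * p)] is at most [2 * q * e], which
    [1 - lam] absorbs by [q_le]. *)
Let yz_le : y + z <= e * (1 + 4 * p) + (1 - lam).
Proof.
have E : y + z = e * (1 + 2 * q) + e * (d * (s + 2 * p)).
  by rewrite /y zE /weight /s /e; ring.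
have dsp : d * (s + 2 * p) <= 4 * p.
  have : 0 <= p * (1 + p - 2 * p ^+ 2 - r ^+ 2 * (1 + 3 * p)) * (1 + 2 * p).
    by rewrite !mulr_ge0 ?subr_ge0//; move: p0; lra.
  have : 0 <= d * (1 - s) by rewrite mulr_ge0// subr_ge0 /s addrC.
  (* After [s <= 1] and [r2_le] the claim becomes [1 - 3 * p + 4 * p ^+ 3 >= 0], whose left side is
     [(1 - 2 * p) ^+ 2 * (1 + p)]. *)
  have : 0 <= p * ((1 - 2 * p) ^+ 2 * (1 + p)).
    by rewrite mulr_ge0// mulr_ge0 ?sqr_ge0//; move: p0; lra.
  rewrite /d /e; lra.
have := ler_wpM2l e0 dsp.
have : 2 * (q * (r * (r * p))) <= q * (1 - 2 * (r * p ^+ 2)).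
  rewrite mulrCA; apply: ler_wpM2l => //.
  have : 0 <= r * p * (1 - (r + p)).
    by rewrite !mulr_ge0// subr_ge0.
  by move: rp_le; lra.
by move: q_le; rewrite E /e; lra.
Qed.

Let chiyz_le : chi + y + z <= 2 * lam.
Proof.
have s1 : s <= 1 by rewrite /s addrC.
have sp : 0 <= s - p by rewrite /s addrAC subrr add0r.
(* The factor [r ^+ 2 * (1 + 3 * p)] is isolated so that [r2_le] applies; every other summand is
   visibly nonnegative. *)
have E : 2 * lam - (chi + y + z) = r * (2 * (1 - s) ^+ 2 * (1 + s) +
  2 * p * (1 + 2 * p - r ^+ 2 * (1 + 3 * p) * (s ^+ 3 + s ^+ 2 * p + s * p ^+ 2 - 5 * p ^+ 3))
  + 2 * p * (1 - s) * (2 - s) + 8 * p ^+ 2 * (1 - s)).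
  by rewrite /lam /chi /y /z /weight /d /e /s /r; ring.
rewrite -subr_ge0 E.
have le1 : s ^+ 3 + s ^+ 2 * p + s * p ^+ 2 - 5 * p ^+ 3 <= 1 + p + p ^+ 2.
  have := exprn_ge0 3 p0.
  have : s ^+ 3 <= 1 by rewrite expr_le1.
  have : s ^+ 2 * p <= p by rewrite ler_piMl// expr_le1.
  have : s * p ^+ 2 <= p ^+ 2 by rewrite ler_piMl// exprn_ge0.
  by lra.
have le2 : r ^+ 2 * (1 + 3 * p) * (s ^+ 3 + s ^+ 2 * p + s * p ^+ 2 - 5 * p ^+ 3)
    <= 1 + 2 * p.
  have h1 : 0 <= r ^+ 2 * (1 + 3 * p).
    by rewrite mulr_ge0 ?exprn_ge0//; move: p0; lra.
  have h2 := ler_wpM2l h1 le1.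
  have h3 : 0 <= 1 + p + p ^+ 2 by rewrite addr_ge0 ?exprn_ge0// addr_ge0.
  have h4 := ler_wpM2r h3 r2_le.
  (* The product bounding the left side expands to [1 + 2 * p - p ^+ 3 - 2 * p ^+ 4]. *)
  have := exprn_ge0 3 p0; have := exprn_ge0 4 p0.
  by move: h2 h4; lra.
apply: mulr_ge0 => //; do !apply: addr_ge0; rewrite ?mulr_ge0 ?exprn_ge0 ?subr_ge0//.
- by move: s0; lra.
- by move: s1; lra.
Qed.

(** * Pattern masses and the decrease of the potential *)

Local Notation mass := (pattern_mass p q).
Local Notation T := (word_step (envelope_rule p q)).
Local Notation Z := (pred1 (Some false) : pred (option bool)).
Local Notation O := (pred1 (Some true) : pred (option bool)).
Local Notation Q := (pred1 None : pred (option bool)).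
Local Notation X := (predC1 (Some true) : pred (option bool)).
Local Notation A := (xpredT : pred (option bool)).

Let le_mass := le_mass p0 q0 pq1.

Let mass_X t l1 l2 :
  mass t (l1 ++ X :: l2) = mass t (l1 ++ Z :: l2) + mass t (l1 ++ Q :: l2).
Proof. by apply: mass_split => // -[[]|]. Qed.

Let mass_A t l1 l2 :
  mass t (l1 ++ A :: l2) = mass t (l1 ++ X :: l2) + mass t (l1 ++ O :: l2).
Proof. by apply: mass_split => // -[[]|]. Qed.

Let mass_end t l : mass t l = mass t (rcons l X) + mass t (rcons l O).
Proof. by rewrite -[LHS]mass_rconsT// -!cats1 mass_A. Qed.

(* The mass of the pattern [l] followed by three sites whose common
   neighbour becomes [?]. *)
Let live t l := mass t (l ++ [:: X; X; X]) - mass t (l ++ [:: Z; Z; Z]).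

(** Splits according to the position of the first [?] among the three sites. *)
Let liveE t l : live t l =
  mass t (l ++ [:: Q; X; X]) + mass t (l ++ [:: Z; Q; X]) + mass t (l ++ [:: Z; Z; Q]).
Proof.
rewrite /live mass_X.
have := mass_X t (l ++ [:: Z]) [:: X]; have := mass_X t (l ++ [:: Z; Z]) [::].
rewrite -!catA /=; lra.
Qed.

Let live_le t l : live t l <=
  mass t (l ++ [:: Q; X]) + mass t (l ++ [:: Z; Q]) + mass t (l ++ [:: Z; Z; Q]).
Proof.
rewrite liveE; have := le_mass t (l ++ [:: Q; X]) [:: X].
have := le_mass t (l ++ [:: Z; Q]) [:: X]; rewrite -!catA /=; lra.
Qed.

Let live_leX t l : live t l <= mass t (l ++ [:: X]).
Proof.
rewrite /live; have := le_mass t (l ++ [:: X]) [:: X; X].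
by have := mass_ge0 p0 q0 pq1 t (l ++ [:: Z; Z; Z]); rewrite -!catA /=; lra.
Qed.

Let live_X t l1 l2 :
  live t (l1 ++ X :: l2) = live t (l1 ++ Z :: l2) + live t (l1 ++ Q :: l2).
Proof. by rewrite /live -!catA /= !mass_X; lra. Qed.

(** The functional as a single observable on four sites: the weight of a [?] is read off the three
    letters on its left. *)
Let weight_word (w : seq (option bool)) : R :=
  if w is [:: a; b; c; None] then
    1 + (c == Some false)%:R
    + ((b == Some false) && (c == Some false))%:R
    + ((b == Some true) && (c == Some false))%:R
    + 2 * [&& a == Some true, b == Some false & c == Some false]%:R
    + d * [&& a == Some false, b == Some false & c == Some false]%:R
  else 0.

Let potential t := unknown_mean p q t 4 weight_word.

Let potentialE t : potential t = mass t [:: Q] + mass t [:: Z; Q]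
  + mass t [:: Z; Z; Q] + mass t [:: O; Z; Q] + 2 * mass t [:: O; Z; Z; Q]
  + d * mass t [:: Z; Z; Z; Q].
Proof.
have m3 : mass t [:: Q] = mass t [:: A; A; A; Q] by rewrite !mass_consT.
have m2 : mass t [:: Z; Q] = mass t [:: A; A; Z; Q] by rewrite !mass_consT.
have m1 P : mass t [:: P; Z; Q] = mass t [:: A; P; Z; Q] by rewrite !mass_consT.
rewrite m3 m2 !m1 /pattern_mass /= -!unknown_meanZ// -!unknown_meanD//.
apply: eq_unknown_mean => // -[|a [|b [|c [|x [|]]]]] //= _.
by case: x => [x|]; rewrite /= ?andbF ?andbT ?andbA ?mulr0 ?addr0// -?andbA.
Qed.

(* The last two terms come from the 1s created by old triples 000. *)
Let step_weight_word v : size v = 6%N ->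
  let I (l : seq (pred (option bool))) : R := (all2 (fun P : pred _ => P) l v)%:R in
  T weight_word v =
    lam * (I [:: A; A; A; X; X; X] - I [:: A; A; A; Z; Z; Z])
  + chi * (I [:: A; A; O; X; X; X] - I [:: A; A; O; Z; Z; Z])
  + y * (I [:: A; O; X; X; X; X] - I [:: A; O; X; Z; Z; Z])
  + z * (I [:: O; X; X; X; X; X] - I [:: O; X; X; Z; Z; Z])
  + e * (I [:: A; Z; Z; Z; X; X] - I [:: A; Z; Z; Z; Z; Z])
  + 2 * (e * p) * (I [:: Z; Z; Z; X; X; X] - I [:: Z; Z; Z; Z; Z; Z]).
Proof.
case: v => [|v0 [|v1 [|v2 [|v3 [|v4 [|v5 [|]]]]]]] //= _.
set f := envelope_rule p q.
(* The updated letters are independent, so the mean of each indicator factorises. *)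
have -> : T weight_word [:: v0; v1; v2; v3; v4; v5] = f v3 v4 v5 None *
  (1 + f v2 v3 v4 (Some false) + f v1 v2 v3 (Some false) * f v2 v3 v4 (Some false)
   + f v1 v2 v3 (Some true) * f v2 v3 v4 (Some false)
   + 2 * (f v0 v1 v2 (Some true) * f v1 v2 v3 (Some false) * f v2 v3 v4 (Some false))
   + d * (f v0 v1 v2 (Some false) * f v1 v2 v3 (Some false) * f v2 v3 v4 (Some false))).
  do !rewrite word_step_cons !big_option_bool.
  rewrite /word_step /weight_word /=.
  have E a b c : f a b c None = 1 - f a b c (Some true) - f a b c (Some false).
    have := envelope_rule_sum1 p q a b c; rewrite big_option_bool -/f; lra.
  rewrite -/f !E.
  ring.
(* [L] indicates that the last three old letters contain [?] but no 1, that is, that their [nor3] is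
   [?]. *)
pose L : R := [&& v3 != Some true, v4 != Some true & v5 != Some true]%:R
     - [&& v3 == Some false, v4 == Some false & v5 == Some false]%:R.
have -> : f v3 v4 v5 None = r * L.
  by rewrite /f /envelope_rule /nor3 /L /r {L}; case: v3 v4 v5 => [[]|] [[]|] [[]|] /=; ring.
transitivity (L * (lam + chi * (v2 == Some true)%:R
   + y * ((v1 == Some true) && (v2 != Some true))%:R
   + z * [&& v0 == Some true, v1 != Some true & v2 != Some true]%:R
   + e * [&& v1 == Some false, v2 == Some false & v3 == Some false]%:R
   + 2 * (e * p) * [&& v0 == Some false, v1 == Some false & v2 == Some false]%:R)); last first.
  rewrite /L; generalize lam chi y z e => l' c' y' z' e'; clear.
  by case: v0 => [[]|]; case: v1 => [[]|]; case: v2 => [[]|]; case: v3 => [[]|];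
    rewrite /= ?andbT; ring.
have [->|] := eqVneq L 0; first by rewrite mulr0 !mul0r.
rewrite mulrAC [RHS]mulrC; move=> L0; congr (_ * L).
(* When [L] is nonzero, [v3] and [v4] are not 1, and the remaining factor does not involve [v5]. *)
have [v3N v4N] : v3 != Some true /\ v4 != Some true.
  by move: L0; rewrite /L {L}; case: v3 v4 v5 => [[]|] [[]|] [[]|]; rewrite ?subrr ?eqxx.
rewrite /lam /chi /y /z /weight /s /e /r.
generalize d => d'; rewrite /f /envelope_rule /nor3; clear -v3N v4N.
case: v3 v4 v3N v4N => [[]|] [[]|] //= _ _; case: v2 => [[]|] /=; case: v1 => [[]|] /=;
  case: v0 => [[]|] /=; ring.
Qed.

Let potentialS t : potential t.+1 = lam * live t [::] + chi * live t [:: O]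
  + y * live t [:: O; X] + z * live t [:: O; X; X]
  + e * (mass t [:: Z; Z; Z; X; X] - mass t [:: Z; Z; Z; Z; Z])
  + 2 * (e * p) * live t [:: Z; Z; Z].
Proof.
have A3 P P' P'' : mass t [:: P; P'; P''] = mass t [:: A; A; A; P; P'; P''].
  by rewrite !mass_consT.
have A2 P l : mass t [:: O, P & l] = mass t [:: A, A, O, P & l].
  by rewrite !mass_consT.
have A1 P l : mass t (P :: l) = mass t [:: A, P & l] by rewrite mass_consT.
rewrite /live /= !A3 (A2 X [:: X; X]) (A2 Z [:: Z; Z]).
rewrite (A1 O [:: X; X; X; X]) (A1 O [:: X; Z; Z; Z]).
rewrite (A1 Z [:: Z; Z; X; X]) (A1 Z [:: Z; Z; Z; Z]).
rewrite /pattern_mass /= -!unknown_meanB// -!unknown_meanZ// -!unknown_meanD//.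
by rewrite /potential unknown_meanS; apply: eq_unknown_mean => // v /step_weight_word.
Qed.

(* The [chi], [y] and [z] terms arise from three shifted windows around the same
   1, so that by shift invariance they are all charged to the first old [?] after
   this 1, whence the condition [chi + y + z <= 2 * lam]. The terms in [e] are
   charged to 000?, which is what [d] is chosen for. *)
Let potential_decay t : (1 - lam) * mass t [:: Q] <= potential t - potential t.+1.
Proof.
rewrite potentialE potentialS.
(* Complements at the right end trade X for O with a minus sign; reflection then moves the O to the
   left end. *)
have L : live t [::] = mass t [:: Q] + mass t [:: Z; Q] + mass t [:: Z; Z; Q]
    - mass t [:: O; Q] - mass t [:: O; Z; Q] - mass t [:: O; Q; X].
  have := liveE t [::]; rewrite /= => ->.
  have := mass_X t [:: O; Q] [::]; have := mass_X t [:: O] [:: Q].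
  have := mass_end t [:: Q; X]; have := mass_end t [:: Q].
  have := mass_end t [:: Z; Q]; have := mass_rev p0 q0 pq1 t [:: Q; X; O].
  have := mass_rev p0 q0 pq1 t [:: Q; O]; have := mass_rev p0 q0 pq1 t [:: Z; Q; O].
  by rewrite /rev /=; lra.
have hchi := live_le t [:: O].
(* Here and in [hz] the sites X after the 1 are split so that each term ends at, or is bounded at,
   the first [?] after this 1. *)
have hy : live t [:: O; X] <= mass t [:: O; Q; X] + (mass t [:: O; Z; Q]
    + mass t [:: O; Z; Z; Q] + mass t [:: O; Z; Z; Z; Q]).
  have -> := live_X t [:: O] [::].
  have := live_leX t [:: O; Q]; have := live_le t [:: O; Z].
  by have := le_mass t [:: O; Z; Q] [:: X]; rewrite /=; lra.
have hz : live t [:: O; X; X] <= mass t [:: O; Q; X] + mass t [:: O; Z; Q]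
    + (mass t [:: O; Z; Z; Q] + mass t [:: O; Z; Z; Z; Q]
    + mass t [:: O; Z; Z; Z; Z; Q]).
  have := live_X t [:: O] [:: X]; have := live_X t [:: O; Z] [::].
  have := live_leX t [:: O; Q; X]; have := le_mass t [:: O; Q; X] [:: X].
  have := live_leX t [:: O; Z; Q]; have := le_mass t [:: O; Z; Q] [:: X].
  have := live_le t [:: O; Z; Z]; have := le_mass t [:: O; Z; Z; Q] [:: X].
  by rewrite /=; lra.
have hN : mass t [:: Z; Z; Z; X; X] - mass t [:: Z; Z; Z; Z; Z] <=
    mass t [:: Z; Z; Z; Q] + mass t [:: Z; Z; Z; Z; Q].
  have := mass_X t [:: Z; Z; Z] [:: X]; have := mass_X t [:: Z; Z; Z; Z] [::].
  by have := le_mass t [:: Z; Z; Z; Q] [:: X]; rewrite /=; lra.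
have hK := live_le t [:: Z; Z; Z].
have hOQ := mass_end t [:: O; Q].
have m0 := mass_ge0 p0 q0 pq1 t.
have hT := mass_A t [::] [:: Z; Z; Z; Q]; rewrite mass_X mass_consT//= in hT.
have hT4 := mass_A t [::] [:: Z; Z; Z; Z; Q]; rewrite mass_X mass_consT//= in hT4.
have lam1 : 0 <= 1 - lam.
  apply: le_trans q_le; apply: mulr_ge0 => //.
  have : r * p * p <= r * p by rewrite ler_piMr// mulr_ge0.
  by move: rp_le; lra.
have C0 : 0 <= 2 * lam - (chi + y + z) by rewrite subr_ge0.
have lam0 : 0 <= lam by move: chi_ge0 y_ge0 z_ge0 chiyz_le; lra.
have ep0 : 0 <= e * p by rewrite mulr_ge0.
have e4p : 0 <= e * (1 + 4 * p) by move: e0 ep0; lra.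
have yz0 : 0 <= e * (1 + 4 * p) + (1 - lam) - (y + z) by rewrite subr_ge0.
have zp0 : 0 <= 2 * (e * p) - z by rewrite subr_ge0.
have hT3 := mass_A t [::] [:: Z; Z; Q]; rewrite mass_X mass_consT//= in hT3.
have hKX := le_mass t [:: Z; Z; Z; Q] [:: X].
rewrite L /= in hchi hK hKX *.
(* From here on, the products certifying the inequality are listed; the final [lra] combines them
   linearly. *)
have bchi := ler_wpM2l chi_ge0 hchi; have by_ := ler_wpM2l y_ge0 hy.
have bz := ler_wpM2l z_ge0 hz; have bN := ler_wpM2l e0 hN.
have bK := ler_wpM2l ep0 hK; have bKX := ler_wpM2l ep0 hKX.
have c1 := mulr_ge0 C0 (m0 [:: O; Q; X]); have c2 := mulr_ge0 C0 (m0 [:: O; Z; Q]).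
have c3 := mulr_ge0 C0 (m0 [:: O; Z; Z; Q]).
have c4 := mulr_ge0 lam1 (m0 [:: O; Z; Q]); have c5 := mulr_ge0 lam1 (m0 [:: O; Z; Z; Q]).
have c6 : 0 <= lam * (mass t [:: O; Q] - mass t [:: O; Q; X]).
  by rewrite mulr_ge0// hOQ /=; move: (m0 [:: O; Q; O]); lra.
have c7 := mulr_ge0 lam1 (m0 [:: Z; Q]).
have c8 : 0 <= (1 - lam) * (mass t [:: Z; Z; Q] - mass t [:: O; Z; Z; Z; Q]).
  rewrite mulr_ge0// hT3 hT.
  move: (m0 [:: Q; Z; Z; Q]) (m0 [:: O; Z; Z; Q]) (m0 [:: Q; Z; Z; Z; Q]).
  by move: (m0 [:: Z; Z; Z; Z; Q]); lra.
have c9 := mulr_ge0 yz0 (m0 [:: O; Z; Z; Z; Q]).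
(* The choice of [d]: on 000? the terms of [bN] and [bK] use [e + 2 * e * p] of [e * (2 + 6 * p)].
   The rest, [e * (1 + 4 * p)], passes to 1000? for [yz_le] and to 0000?, where after the same
   payment [2 * e * p] is left for 10000? and 00000?. *)
have c10 : 0 <= e * (1 + 4 * p) * (mass t [:: Z; Z; Z; Q]
    - mass t [:: O; Z; Z; Z; Q] - mass t [:: Z; Z; Z; Z; Q]).
  by rewrite mulr_ge0// hT; move: (m0 [:: Q; Z; Z; Z; Q]); lra.
have c11 := mulr_ge0 zp0 (m0 [:: O; Z; Z; Z; Z; Q]).
have c12 : 0 <= e * p * (mass t [:: Z; Z; Z; Z; Q]
    - mass t [:: O; Z; Z; Z; Z; Q] - mass t [:: Z; Z; Z; Z; Z; Q]).
  by rewrite mulr_ge0// hT4; move: (m0 [:: Q; Z; Z; Z; Z; Q]); lra.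
rewrite /d.
move: bchi by_ bz bN bK bKX c1 c2 c3 c4 c5 c6 c7 c8 c9 c10 c11 c12.
lra.
Qed.

(** Telescoping: the potential is nonnegative, so its total decrease is at most its initial
    value. *)
Lemma sum_mass_unknown_bounded : 0 < p + q ->
  exists B, forall n, \sum_(t < n) unknown_mass p q t <= B.
Proof.
move=> /lam_lt1 lam1; exists (potential 0 / (1 - lam)) => n.
have lam_gt0 : 0 < 1 - lam by rewrite subr_gt0.
rewrite ler_pdivlMr// mulrC mulr_sumr.
apply: (@le_trans _ _ (potential 0 - potential n)); last first.
  rewrite gerBl potentialE.
  by rewrite !addr_ge0 ?mass_ge0// mulr_ge0// mass_ge0.
elim: n => [|n IH]; first by rewrite big_ord0 subrr.
by rewrite big_ord_recr /=; have := potential_decay n; rewrite /unknown_mass; lra.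
Qed.

End decay.

(** * Words read off a configuration *)

Section windows.
Variable A : alphabetType.
Implicit Types (eta xi : config A) (x : int) (n : nat) (w : seq A).

Definition window x n : seq int := mkseq (fun i => x + i%:Z) n.

Definition word x n eta : seq A := [seq (eta y : A) | y <- window x n].

Definition word_cylinder x w : set (config A) := [set eta | word x (size w) eta = w].

(* A configuration carrying [w] at [x], with junk letters outside. *)
Definition config_of x w : config A := fun y => nth point w `|y - x|%N.

Lemma size_window x n : size (window x n) = n.
Proof. exact: size_mkseq. Qed.

Lemma window_uniq x n : uniq (window x n).
Proof. by apply: mkseq_uniq => i j /addrI [->]. Qed.

Lemma size_word x n eta : size (word x n eta) = n.
Proof. by rewrite size_map size_window. Qed.

Lemma eq_word x n eta xi :
  (forall y, y \in window x n -> eta y = xi y) <-> word x n eta = word x n xi.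
Proof. by rewrite /word; split=> [/eq_in_map//|/eq_in_map]. Qed.

Lemma nth_word x n eta i : (i < n)%N -> nth point (word x n eta) i = eta (x + i%:Z).
Proof.
by move=> ni; rewrite (nth_map 0) ?size_window// nth_mkseq.
Qed.

Lemma word_config_of x w : word x (size w) (config_of x w) = w.
Proof.
apply: (@eq_from_nth _ point); rewrite size_word// => i iw.
by rewrite nth_word// /config_of addrC addKr absz_nat.
Qed.

Lemma word_cylinderE x w : word_cylinder x w =
  elem_cylinder (window x (size w)) (config_of x w).
Proof.
apply/seteqP; split => eta; rewrite /word_cylinder/elem_cylinder/=.
  by move=> h; apply/eq_word; rewrite h word_config_of.
by move=> /eq_word ->; rewrite word_config_of.
Qed.

Lemma window_cover (J : seq int) : exists n, forall m, (n <= m)%N ->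
  {subset J <= window (- m%:Z) m.*2.+1}.
Proof.
exists (\max_(j <- J) `|j|%N)%N => m nm j jJ.
have jm : (`|j| <= m)%N.
  by apply: leq_trans nm; rewrite (big_rem j)//= leq_max leqnn.
apply/mapP; exists (absz (j + m%:Z)); first by rewrite mem_iota; lia.
by lia.
Qed.

Lemma depends_on_word U x n J (g : config A -> U) : {subset J <= window x n} ->
  depends_on J g -> forall eta, g eta = g (config_of x (word x n eta)).
Proof.
move=> Jx gJ eta; apply: gJ => y /Jx; move: y; apply/eq_word.
by have := word_config_of x (word x n eta); rewrite size_word => ->.
Qed.

Lemma word_dep x n U (G : seq A -> U) : depends_on (window x n) (G \o word x n).
Proof. by move=> eta xi /eq_word /= ->. Qed.

End windows.

(** * Means of local observables as finite sums *)

Section window_mean.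
Variables (A : alphabetType) (R : realType).
Implicit Types (mu nu P Q : probability (config A) R) (x : int) (n : nat).
Implicit Types (G H : seq A -> R).

(** A finite sum of cylinder probabilities, so that limits in the law can be taken term by term;
    [integral_word] identifies it with an integral. *)
Definition word_mean mu x n G : R :=
  \sum_(w : n.-tuple A) G w * fine (mu (word_cylinder x w)).

Lemma measurable_word_cylinder x (w : seq A) : measurable (word_cylinder x w).
Proof.
apply: measurable_cylinder; exists (window x (size w)).
by rewrite word_cylinderE; exact: elem_cylinder_dep.
Qed.

Lemma integral_word mu x n G :
  (\int[mu]_eta (G (word x n eta))%:E)%E = (word_mean mu x n G)%:E.
Proof.
rewrite /word_mean -sumEFin.
transitivity (\int[mu]_eta (\sum_(w : n.-tuple A)
    (G w * \1_(word_cylinder x w) eta)%:E))%E.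
  apply: eq_integral => eta _; rewrite sumEFin; congr _%:E.
  have sw : size (word x n eta) == n by rewrite size_word.
  rewrite (bigD1 (Tuple sw))//= big1 ?addr0.
    by rewrite indicE mem_set ?mulr1//= /word_cylinder/= size_word.
  move=> w wE; rewrite indicE memNset ?mulr0// /word_cylinder/= size_tuple => ew.
  by move/eqP: wE; apply; apply: val_inj.
have intw (w : n.-tuple A) : mu.-integrable setT
    (fun eta => (G w * \1_(word_cylinder x w) eta)%:E).
  apply: (eq_integrable _ (fun eta => (G w)%:E * (\1_(word_cylinder x w) eta)%:E)%E) => //.
  apply: integrableZl => //; apply: integrable_indic => //.
  exact: measurable_word_cylinder.
rewrite integral_sum//; apply: eq_bigr => w _.
under eq_integral do rewrite EFinM.
rewrite integralZl//; last first.
  by apply: integrable_indic => //; exact: measurable_word_cylinder.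
rewrite integral_indic ?setIT//; last exact: measurable_word_cylinder.
by rewrite EFinM fineK// fin_num_measure//; exact: measurable_word_cylinder.
Qed.

Lemma word_meanE mu x n G : word_mean mu x n G = fine (\int[mu]_eta (G (word x n eta))%:E)%E.
Proof. by rewrite integral_word. Qed.

Lemma word_mean_le mu x n G k : (forall w, size w = n -> G w <= k) ->
  word_mean mu x n G <= k.
Proof.
move=> Gk; have <- : word_mean mu x n (fun=> k) = k.
  by rewrite word_meanE integral_cst// [X in (_ * X)%E]probability_setT mule1.
apply: ler_sum => w _; apply: ler_wpM2r; first by rewrite fine_ge0.
by rewrite Gk// size_tuple.
Qed.

Lemma word_meanN mu x n G : word_mean mu x n (fun w => - G w) = - word_mean mu x n G.
Proof. by rewrite -sumrN; apply: eq_bigr => w _; rewrite mulNr. Qed.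

Lemma measure_cylinder_word mu x n J (S : set (config A)) :
  {subset J <= window x n} -> depends_on J S ->
  mu S = (word_mean mu x n (fun w => \1_S (config_of x w)))%:E.
Proof.
move=> Jx SJ; have mS : measurable S by apply: measurable_cylinder; exists J.
have -> : mu S = (\int[mu]_eta (\1_S eta)%:E)%E by rewrite integral_indic// setIT.
rewrite -integral_word.
apply: eq_integral => eta _; congr _%:E.
apply: (@depends_on_word _ _ _ _ _ (\1_S : config A -> R) Jx).
by move=> xi zeta e; rewrite !indicE; congr (nat_of_bool _)%:R;
  apply/idP/idP; rewrite !inE (SJ _ _ e).
Qed.

Lemma eq_measure_word P Q :
  (forall x n G, word_mean P x n G = word_mean Q x n G) -> P ≡μ Q.
Proof.
move=> PQ; apply: eq_measure_elem_cylinder => J b _.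
have [n /(_ _ (leqnn n)) Jn] := window_cover J.
by rewrite !(measure_cylinder_word _ Jn (@elem_cylinder_dep _ J b)) PQ.
Qed.

End window_mean.

(** * Transition probabilities between words *)

Section word_step_decomposition.
Variables (R : realFieldType) (S : finType) (phi : S -> S -> S -> S -> R).

Lemma word_step_sum I (s : seq I) (F : I -> seq S -> R) v :
  word_step phi (fun u => \sum_(i <- s) F i u) v =
  \sum_(i <- s) word_step phi (F i) v.
Proof.
elim: s => [|i s IH].
  rewrite big_nil -[RHS](mul0r (word_step phi (fun=> 0) v)) -word_stepZ.
  by apply: eq_word_step => w _; rewrite big_nil mul0r.
rewrite big_cons -IH -word_stepD.
by apply: eq_word_step => w _; rewrite big_cons.
Qed.

(** On the indicator of [w], [word_step] is the transition probability from [v] to [w]; the rest is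
    linearity. *)
Lemma word_step_indic G n v : size v = n.+2 -> word_step phi G v =
  \sum_(w : n.-tuple S) G w * word_step phi (fun u => (u == w)%:R) v.
Proof.
move=> sv; under eq_bigr do rewrite -word_stepZ.
rewrite -word_step_sum; apply: eq_word_step => u; rewrite sv subn2 => /= su.
have su' : size u == n by rewrite su.
rewrite (bigD1 (Tuple su'))//= eqxx mulr1 big1 ?addr0// => w wu.
case: eqP => [uw|]; last by rewrite mulr0.
by move/eqP: wu; case; apply: val_inj.
Qed.

Lemma word_step_cons_indic a b c v x w :
  word_step phi (fun u => (u == x :: w)%:R) [:: a, b, c & v] =
  phi a b c x * word_step phi (fun u => (u == w)%:R) [:: b, c & v].
Proof.
rewrite word_step_cons (bigD1 x)//= [X in _ + X]big1 ?addr0.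
  by congr (_ * _); apply: eq_word_step => u _; rewrite eqseq_cons eqxx.
move=> y yx; rewrite (@eq_word_step _ _ _ _ (fun u => 0 * 0)) ?word_stepZ ?mul0r ?mulr0//.
by move=> u _; rewrite eqseq_cons (negPf yx)/= ?mulr0.
Qed.

End word_step_decomposition.

(** * The automaton acting on window means *)

Section dynamics.
Variables (R : realType) (p q : R).
Hypotheses (p01 : 0 <= p <= 1) (q01 : 0 <= q <= 1).
Local Notation F := (pca_pq p01 q01).
Local Notation T := (word_step (nor_rule p q)).
Implicit Types (mu nu : probability (config bool) R) (eta : config bool).

Lemma pca_localE eta x b : pca_local F eta x b =
  nor_rule p q (eta x) (eta (x + 1)) (eta (x + 2)) b.
Proof.
rewrite /pca_local /= /rule_pq /nor_rule.
have -> : [tuple (eta (x + tnth [tuple 0; 1; 2 : int] i) : bool) | i < 3] =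
    [tuple eta x; eta (x + 1); eta (x + 2)].
  apply: eq_from_tnth => -[[|[|[|i]]] i3] //; rewrite tnth_mktuple.
  - by rewrite !(tnth_nth false) !(tnth_nth 0) /= addr0.
  - by rewrite !(tnth_nth false) !(tnth_nth 0).
  - by rewrite !(tnth_nth false) !(tnth_nth 0).
rewrite -val_eqE /=.
by case: (eta x) (eta (x + 1)) (eta (x + 2)) b => [] [] [] [] /=; ring.
Qed.

Lemma word_cons x n eta : word x n.+1 eta = eta x :: word (x + 1) n eta.
Proof.
rewrite /word /window /mkseq /= addr0; congr (_ :: _).
rewrite -[1%N]addn0 iotaDl -!map_comp; apply: eq_map => i /=.
by rewrite -addrA -PoszD.
Qed.

Lemma prod_pca_local x (w : seq bool) eta :
  \prod_(y <- window x (size w)) pca_local F eta y (config_of x w y) =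
  T (fun u => (u == w)%:R) (word x (size w).+2 eta).
Proof.
pose f x := nor_rule p q (eta x) (eta (x + 1)) (eta (x + 2)).
transitivity (\prod_(i < size w) f (x + i%:Z) (nth point w i)).
  rewrite big_map (_ : iota 0 _ = index_iota 0 (size w)) ?big_mkord; last first.
    by rewrite /index_iota subn0.
  apply: eq_bigr => i _; rewrite pca_localE.
  by rewrite /config_of addrC addKr absz_nat.
elim: w x => [|b w IH] x; first by rewrite big_ord0.
rewrite [size _]/= !word_cons word_step_cons_indic big_ord_recl addr0 -addrA.
congr (_ * _); have := IH (x + 1); rewrite !word_cons -addrA => <-.
by apply: eq_bigr => i _; rewrite -addrA -PoszD.
Qed.

(** Duality: a step of the law is a step of [T] on the observable, which then reads two more
    sites. *)
Lemma word_mean_step mu x n (G : seq bool -> R) :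
  word_mean (pca_step F mu) x n G = word_mean mu x n.+2 (T G).
Proof.
transitivity (\sum_(w : n.-tuple bool)
    G w * word_mean mu x n.+2 (T (fun u => (u == w)%:R))).
  apply: eq_bigr => w _; congr (_ * _).
  rewrite word_cylinderE size_tuple pca_stepE ?window_uniq//.
  rewrite word_meanE; congr fine; apply: eq_integral => eta _.
  by have := prod_pca_local x w eta; rewrite size_tuple => ->.
rewrite /word_mean; under eq_bigr do rewrite mulr_sumr.
rewrite exchange_big /=; apply: eq_bigr => v _.
rewrite (@word_step_indic _ _ _ _ n) ?size_tuple// mulr_suml.
by apply: eq_bigr => w _; rewrite mulrA.
Qed.

Lemma word_mean_iter t mu x n (G : seq bool -> R) :
  word_mean (iter t (pca_step F) mu) x n G =
  word_mean mu x (n + t.*2) (iter t T G).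
Proof.
elim: t n G => [|t IH] n G; first by rewrite addn0.
by rewrite iterS word_mean_step IH -iterSr doubleS !addnS !addSn.
Qed.

End dynamics.

(** * Approximation of continuous functions by local ones *)

Section local_approximation.
Variable A : alphabetType.
Implicit Types (eta xi : config A).

(** The cylinders around [eta] generate a filter, and in the product topology its convergence to
    [eta] is checked one coordinate at a time. *)
Lemma nbhs_elem_cylinder eta (V : set (config A)) : nbhs eta V ->
  exists J, elem_cylinder J eta `<=` V.
Proof.
pose G : set_system (config A) := [set W | exists J, elem_cylinder J eta `<=` W].
have FG : Filter G.
  split; first by exists [::].
    move=> P Q [J JP] [K KQ]; exists (J ++ K) => xi e.
    by split; [apply: JP|apply: KQ] => y yJ; apply: e; rewrite mem_cat yJ ?orbT.
  by move=> P Q PQ [J JP]; exists J; apply: subset_trans PQ.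
suff : G --> eta by exact.
have onto i : (fun xi : config A => xi i) @` setT = setT.
  by apply/seteqP; split=> [//|a _]; exists ((fun=> a) : config A).
apply/cvg_sup => i; apply/cvg_image => //.
move=> B /nbhs_singleton Bi; exists ((fun xi : config A => xi i) @^-1` B).
  by exists [:: i] => xi /(_ i); rewrite inE eqxx => /(_ isT) /= ->.
by rewrite image_preimage.
Qed.

Definition truncate n eta : config A :=
  config_of (- n%:Z) (word (- n%:Z) n.*2.+1 eta).

(** Each point has a cylinder on which [f] stays within [e / 2] of its value there; once the window
    covers its support, [xi] and its truncation both lie in it. Compactness makes [n] uniform. *)
Lemma truncate_uniform (R : realType) (f : config A -> R) (e : R) :
  continuous f -> 0 < e ->
  \forall n \near \oo, forall eta, `|f eta - f (truncate n eta)| <= e.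
Proof.
move=> cf e0.
have /compact_near_coveringP cov := @compact_config A.
suff : \forall n \near \oo,
    [set: config A] `<=` (fun eta => `|f eta - f (truncate n eta)| <= e).
  by apply: filterS => n h eta; exact: h.
apply: cov => eta _.
have e2 : 0 < e / 2 by rewrite divr_gt0.
have /cvgrPdist_le /(_ _ e2) /nbhs_elem_cylinder [J JV] := cf eta.
have [N NJ] := window_cover J.
exists (elem_cylinder J eta, [set n | (N <= n)%N]).
  split=> /=; last exact: nbhs_infty_ge.
  apply: open_nbhs_nbhs; split; last by [].
  by apply: open_cylinder; exists J; exact: elem_cylinder_dep.
move=> [xi n] [/= Jxi Nn].
have := JV _ Jxi; have : `|f eta - f (truncate n xi)| <= e / 2.
  apply: JV => y yJ; rewrite -Jxi//.
  have := NJ n Nn y yJ; move: y {yJ}.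
  apply/eq_word; rewrite /truncate.
  by have := word_config_of (- n%:Z) (word (- n%:Z) n.*2.+1 xi); rewrite size_word.
rewrite /=; move=> h1 h2; rewrite [e]splitr.
rewrite -[_ - _](subrKA (f eta)) (le_trans (ler_normD _ _))// lerD//.
by rewrite distrC.
Qed.

Lemma continuous_measurable (R : realType) (f : config A -> R) :
  continuous f -> measurable_fun setT f.
Proof.
move=> cf; apply: (@measurable_fun_cvg _ _ _ _ (fun n => f \o truncate n)).
  move=> n; apply: depends_on_measurable.
  exact: (word_dep (fun w => f (config_of (- n%:Z) w))).
move=> eta _; apply/cvgrPdist_le => e e0.
by apply: filterS (truncate_uniform cf e0) => n; exact.
Qed.

End local_approximation.

(** * Ergodicity *)

Section ergodicity.
Variables (R : realType) (p q : R).
Hypotheses (p01 : 0 <= p <= 1) (q01 : 0 <= q <= 1) (pq : 0 < p + q <= 1).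
Local Notation F := (pca_pq p01 q01).
Local Notation T := (word_step (nor_rule p q)).
Implicit Types (mu nu : probability (config bool) R) (eta : config bool).
Implicit Types (G : seq bool -> R) (S : set (config bool)).

Let p0 : 0 <= p. Proof. by case/andP: p01. Qed.
Let q0 : 0 <= q. Proof. by case/andP: q01. Qed.
Let pq1 : p + q <= 1. Proof. by case/andP: pq. Qed.

Lemma unknown_mass_cvg0 : unknown_mass p q t @[t --> \oo] --> 0.
Proof.
have [|B sumB] := sum_mass_unknown_bounded p0 q0 pq1; first by case/andP: pq.
apply: cvg_series_cvg_0; apply: nondecreasing_is_cvgn.
  apply/nondecreasing_seqP => n.
  by rewrite /series /= big_nat_recr//= lerDl mass_ge0.
by exists B => _ [n _ <-]; rewrite /series /= big_mkord.
Qed.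

(** Each mean averages [iter t T G'] over words, and [word_iter_osc] makes this function nearly
    constant. Uniformity in [mu] and [nu] later gives the Cauchy property. *)
Lemma word_mean_forget x n G e : 0 < e -> \forall t \near \oo, forall mu nu,
  `|word_mean (iter t (pca_step F) mu) x n G -
    word_mean (iter t (pca_step F) nu) x n G| <= e.
Proof.
move=> e0.
(* [word_iter_osc] wants an oscillation bound over words of all lengths, hence the value 0 off
   length [n]. *)
pose G' w := if size w == n then G w else 0.
have meanG' mu : word_mean mu x n G = word_mean mu x n G'.
  by apply: eq_bigr => w _; rewrite /G' size_tuple eqxx.
pose B := \sum_(w : n.-tuple bool) `|G w|.
have B0 : 0 <= B by apply: sumr_ge0.
have G'B w : `|G' w| <= B.
  rewrite /G'; case: eqP => [/eqP sw|_]; last by rewrite normr0.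
  by rewrite /B (bigD1 (Tuple sw))//= lerDl sumr_ge0.
have oscB w w' : G' w - G' w' <= 2 * B.
  by apply: le_trans (ler_norm _) _; apply: le_trans (ler_normB _ _) _;
    rewrite mulr_natl mulr2n lerD.
(* The summand 1 keeps the denominator positive; 4 is the oscillation factor 2 times the two
   comparisons with [v0]. *)
have B4 : 0 < 4 * (B * n%:R) + 1 by rewrite ltr_wpDl// !mulr_ge0.
have eB : 0 < e / (4 * (B * n%:R) + 1) by rewrite divr_gt0.
have /cvgrPdist_le /(_ _ eB) := unknown_mass_cvg0.
apply: filterS => t; rewrite sub0r normrN ger0_norm ?mass_ge0// ler_pdivlMr// => ut.
pose D := 2 * B * (n%:R * unknown_mass p q t).
have D2 : D + D <= e.
  apply: le_trans ut; rewrite /D.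
  have : 0 <= unknown_mass p q t by exact: mass_ge0.
  lra.
pose v0 := nseq (n + t.*2) false.
have near_v0 mu : `|word_mean (iter t (pca_step F) mu) x n G - iter t T G' v0| <= D.
  rewrite meanG' word_mean_iter ler_norml lerBlDr lerBrDr.
  have osc v v' : size v = (n + t.*2)%N -> size v' = (n + t.*2)%N ->
    iter t T G' v - iter t T G' v' <= D.
    by apply: word_iter_osc => //; rewrite mulr_ge0.
  have sv0 : size v0 = (n + t.*2)%N by rewrite size_nseq.
  apply/andP; split; last first.
    by apply: word_mean_le => w sw; rewrite -lerBlDr osc.
  rewrite -lerN2 -word_meanN; apply: word_mean_le => w sw.
  by have := osc _ _ sv0 sw; lra.
move=> mu nu; apply: le_trans D2.
rewrite -(subrKA (iter t T G' v0)) (le_trans (ler_normD _ _))// lerD//.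
by rewrite distrC.
Qed.

Let mu_ t := iter t (pca_step F) (pca_image F point).

Lemma cylinder_word S : cylinder S ->
  exists x n, exists2 J, {subset J <= window x n} & depends_on J S.
Proof.
move=> [J SJ]; have [n /(_ _ (leqnn n)) Jn] := window_cover J.
by exists (- n%:Z), n.*2.+1, J.
Qed.

Lemma cvg_cylinder S : cylinder S -> cvgn (fun t => fine (mu_ t S)).
Proof.
move=> /cylinder_word [x [n [J Jx SJ]]].
apply/cauchy_cvgP; apply/cauchy_exP => e e0.
have e2 : 0 < e / 2 by rewrite divr_gt0.
have [N _ /(_ N (leqnn N)) /= hN] := word_mean_forget x n
  (fun w => \1_S (config_of x w) : R) e2.
exists (fine (mu_ N S)); exists N => //= t Nt; rewrite /ball /=.
rewrite !(measure_cylinder_word _ Jx SJ) /=.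
apply: le_lt_trans (_ : e / 2 < e); last by rewrite ltr_pdivrMr// ltr_pMr// ltr1n.
(* [mu_ t] is [N] steps applied to [mu_ (t - N)], so both laws are compared after the same number of
   steps. *)
by rewrite /mu_ -(subnKC Nt) iterD; exact: hN.
Qed.

Lemma limit_measure : exists P : probability (config bool) R,
  forall S, cylinder S -> fine (mu_ t S) @[t --> \oo] --> fine (P S).
Proof.
(* The default 0 off cylinders provides the nonnegativity on all sets that [cylinder_extension] asks
   for. *)
pose m S : \bar R := if `[< cylinder S >] then (limn (fun t => fine (mu_ t S)))%:E else 0%E.
have mE S : cylinder S -> m S = (limn (fun t => fine (mu_ t S)))%:E.
  by move=> cS; rewrite /m; case: asboolP.
have [||S S' cS cS' SS'||P PE] := @cylinder_extension _ R m.
- by rewrite mE; [under eq_fun do rewrite measure0; rewrite lim_cst|exact: cylinder0].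
- move=> S; rewrite /m; case: asboolP => // cS; rewrite lee_fin.
  by apply: limr_ge; [exact: cvg_cylinder|apply: nearW => t; exact: fine_ge0].
- rewrite !mE//; last exact: cylinderU.
  rewrite -EFinD -limD; [|exact: cvg_cylinder..]; congr (limn _)%:E.
  apply/funext => t; rewrite measureU//; try exact: measurable_cylinder.
  by rewrite fineD// fin_num_measure//; exact: measurable_cylinder.
- rewrite mE; last by exists [::].
  by under eq_fun do rewrite probability_setT; rewrite lim_cst.
by exists P => S cS; rewrite PE// mE//=; exact: cvg_cylinder.
Qed.

Lemma pca_pq_ergodic : pca_ergodic F.
Proof.
have [P PE] := limit_measure.
have meanP x n G : word_mean (mu_ t) x n G @[t --> \oo] --> word_mean P x n G.
  apply: cvg_big => [|w _]; first exact: add_continuous.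
  apply: cvgM; [exact: cvg_cst|apply: PE]; exists (window x (size w)).
  by rewrite word_cylinderE; exact: elem_cylinder_dep.
have mean_nu nu x n G :
    word_mean (iter t (pca_step F) nu) x n G @[t --> \oo] --> word_mean P x n G.
  apply/cvgrPdist_le => e e0; have e2 : 0 < e / 2 by rewrite divr_gt0.
  have /cvgrPdist_le /(_ _ e2) := meanP x n G.
  apply: filterS2 (word_mean_forget x n G e2) => t hf hP.
  rewrite -(subrKA (word_mean (mu_ t) x n G)) (le_trans (ler_normD _ _))//.
  by rewrite [e]splitr lerD// hf.
exists P; split.
- apply: eq_measure_word => x n G; rewrite word_mean_step.
  (* By duality the sequence is the shifted orbit [mu_ t.+1], so the mean after one step from [P]
     has the same limit. *)
  have h : (fun t => word_mean (mu_ t) x n.+2 (T G)) @ \oo --> word_mean P x n G.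
    rewrite (_ : (fun _ => _) = (fun t => word_mean (mu_ t.+1) x n G)).
      by have := meanP x n G; rewrite -cvg_shiftS.
    by apply/funext => t; rewrite -(word_mean_step p01 q01).
  exact: (cvg_unique _ (meanP x n.+2 (T G)) h).
- move=> nu nuF; apply: eq_measure_word => x n G.
  (* Along the orbit of a stationary law the means are constant, yet they converge to those of
     [P]. *)
  apply: (cvg_unique _ _ (mean_nu nu x n G)) => //.
  rewrite (_ : (fun _ => _) = fun=> word_mean nu x n G); first exact: cvg_cst.
  apply/funext => t; elim: t n G => [//|t IH] n G.
  rewrite iterS word_mean_step IH -(word_mean_step p01 q01).
  apply: eq_bigr => w _; rewrite nuF//; exact: measurable_word_cylinder.
move=> nu f cf bf.
have mf := continuous_measurable cf.
have intf mu : mu.-integrable setT (EFin \o f).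
  by apply: measurable_bounded_integrable => //; exact: fin_num_fun_lty.
(* The truncation error passes to the integrals with a bound independent of the law, so [n] can be
   fixed before [t]. *)
have near_mean mu n e : (forall eta, `|f eta - f (truncate n eta)| <= e) ->
    `|fine (\int[mu]_eta (f eta)%:E)%E -
      word_mean mu (- n%:Z) n.*2.+1 (fun w => f (config_of (- n%:Z) w))| <= e.
  move=> fe; pose g w := f (config_of (- n%:Z) w).
  have intg : mu.-integrable setT (EFin \o (fun eta => g (word (- n%:Z) n.*2.+1 eta))).
    apply: measurable_bounded_integrable => //; first exact: fin_num_fun_lty.
      exact: depends_on_measurable (word_dep g).
    case: bf => M [Mr fM]; exists M; split => // k Mk eta _.
    exact: (fM k Mk (truncate n eta)).
  have := RintegralB (mu := mu) measurableT (intf mu) intg.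
  rewrite word_meanE => <-.
  have intd := integrableB measurableT (intf mu) intg.
  have intc k : mu.-integrable setT (EFin \o (fun=> k)).
    exact: finite_measure_integrable_cst.
  have mean_cst k : (\int[mu]_(x in setT) k)%R = k.
    by rewrite Rintegral_cst// [X in fine X]probability_setT mulr1.
  rewrite ler_norml -{1}(mean_cst (- e)) -{2}(mean_cst e).
  apply/andP; split; apply: le_Rintegral => // eta _;
    by have := fe eta; rewrite ler_norml => /andP[].
have finf mu : (\int[mu]_eta (f eta)%:E)%E \is a fin_num.
  exact: integrable_fin_num (intf mu).
rewrite -(fineK (finf P)).
apply: cvg_EFin; first exact: nearW.
(* One third each for truncation under [P], truncation under the law at time [t], and convergence of
   the window mean. *)
apply/cvgrPdist_le => e e0; have e3 : 0 < e / 3 by rewrite divr_gt0.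
have [n _ /(_ n (leqnn n)) /= fn] := truncate_uniform cf e3.
have /cvgrPdist_le /(_ _ e3) :=
  mean_nu nu (- n%:Z) n.*2.+1 (fun w => f (config_of (- n%:Z) w)).
apply: filterS => t ht.
have := near_mean P n _ fn; have := near_mean (iter t (pca_step F) nu) n _ fn.
move: ht; rewrite /= !ler_norml; lra.
Qed.

End ergodicity.

Theorem theorem1p2 (R : realType) (p q : R)
    (p01 : 0 <= p <= 1) (q01 : 0 <= q <= 1) (pq : 0 < p + q <= 1) :
  pca_ergodic (pca_pq p01 q01).
Proof. exact: pca_pq_ergodic. Qed.
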